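(* Let $\{\xi_j\}_{j\in\mathbb Z}$ be i.i.d. zero-mean real random variables with $E[\xi_1^2]=\iota$ and $\sup_{t\ge0}t^{\alpha}P(\xi_1^2>t)<\infty$ for some $\alpha\in(1,2)$. Let $(c_l)_{l\ge 0}$ be real with $\sup_{l\ge 0}|l|^{\sigma}|c_l|<\infty$ for some $\sigma\in(\tfrac12,1]$, and let $x_k=\sum_{j=0}^{\infty}c_j\xi_{k-j}$. Fix an integer $h\ge 0$ and define $$\hat\gamma_h^{(n)}=\frac1n\sum_{k=1}^{n}x_kx_{k+h},\qquad \gamma_h=E[x_0x_h]=\iota\sum_{j=0}^{\infty}c_jc_{j+h}.$$ Then for every $p$ satisfying $p<\frac{1}{2-2\sigma}\wedge\alpha\wedge 2$, $$n^{1-\frac1p}\bigl[\hat\gamma_h^{(n)}-\gamma_h\bigr]\to 0\quad\text{almost surely as }n\to\infty.$$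
   Context: $a\wedge b=\min\{a,b\}$.
   Formalization: The formal theorem assumes p > 0 (for p < 0 the claim fails, e.g. i.i.d. signs with h = 1; p = 0 is undefined), and takes γ_h as the series ι∑c_j c_{j+h}, without separately proving that it equals E[x_0 x_h]. *)

(* Defs.v *)
From HB Require Import structures.
From mathcomp Require Import all_boot all_order all_algebra.
From mathcomp Require Import all_classical all_reals all_analysis.
Set Implicit Arguments. Unset Strict Implicit. Unset Printing Implicit Defensive.
Import Order.TTheory GRing.Theory Num.Theory.
Import numFieldNormedType.Exports.
Local Open Scope classical_set_scope.
Local Open Scope ring_scope.

Definition mutually_independent d (T : measurableType d) (R : realType)
  (P : probability T R) (I : eqType) (X : I -> T -> R) : Prop :=
  forall (J : seq I) (B : I -> set R), uniq J ->
    (forall i, i \in J -> measurable (B i)) ->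
    P [set w | forall i, i \in J -> B i (X i w)] =
    (\prod_(i <- J) P [set w | B i (X i w)])%E.

Definition identically_distributed d (T : measurableType d) (R : realType)
  (P : probability T R) (I : Type) (X : I -> T -> R) (i0 : I) : Prop :=
  forall i (B : set R), measurable B ->
    P [set w | B (X i w)] = P [set w | B (X i0 w)].

Definition gamma_h (R : realType) (iota : R) (c : nat -> R) (h : nat) : R :=
  iota * limn (fun N => \sum_(0 <= j < N) c j * c (j + h)%N).

Definition gamma_hat (R : realType) (T : Type) (x : int -> T -> R) (h n : nat)
  (w : T) : R :=
  (n%:R)^-1 * \sum_(1 <= k < n.+1) x (k%:Z) w * x (k%:Z + h%:Z) w.

(* Main.v *)
Require Import Defs.
From HB Require Import structures.
From mathcomp Require Import all_boot all_order all_algebra.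
From mathcomp Require Import all_classical all_reals all_analysis.
From mathcomp Require Import measurable_realfun.
From mathcomp Require Import ring lra zify.
Import Order.TTheory GRing.Theory Num.Theory.
Import numFieldNormedType.Exports.
Local Open Scope classical_set_scope.
Local Open Scope ring_scope.

Set Implicit Arguments. Unset Strict Implicit. Unset Printing Implicit Defensive.

(** Since X_k X_(k+h) is a quadratic form in the noise, a block sum of
    X_k X_(k+h) - gamma_h splits into a diagonal part, linear in the centered
    squares xi_u^2 - iota, and an off-diagonal part.  For p < q < alpha the
    centered squares have a finite q-th moment and von Bahr--Esseen bounds the
    q-th moment of the diagonal part of a block of length m by O(m); the
    off-diagonal part is a sum of martingale differences whose variance is
    controlled by the squared autocorrelations of c, and is
    O(m^(1 + beta)) for any beta > max(0, 3 - 4 sigma).  Hence the q-th moment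
    of a block is O(m^theta) with 1 <= theta < q / p.  All dyadic blocks are
    then almost surely bounded simultaneously by a weighted sum over the blocks
    (p-series in the position, geometric series in the scale), and the binary
    expansion of n turns this into a bound o(n^(1/p)) for the partial sums.
    One may assume p >= 1, as n^(1 - 1/p) increases with p. *)

(** * Powers and power sums *)

(** Since alpha < 2, the centered squares need not have a second moment, so the diagonal part is
    only controlled in L^q. The off-diagonal part pairs distinct, independent noise variables, so E
    xi^2 < oo suffices for its variance; [powR_norm_le_sqr] then lowers its exponent from 2 to q.
    The noise is two-sided and x_k is only an almost sure limit, whereas the martingale arguments
    want a first variable. The noise is therefore cut off below -N, and the block bounds are proved
    with constants independent of N, so that Fatou's lemma removes the cut-off. For the cut-off
    process each product is centered by its own partial sum of autocorrelations; this makes the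
    splitting exact, and the centering becomes gamma_h only as N grows. After a q-th root the block
    exponents are 1/q and (1 + beta)/2, and both must stay below 1/p. The first asks for p < q <
    alpha; the second leaves room for beta >= 0 when p < 2, and for beta > 3 - 4 sigma when p < 1/(2
    - 2 sigma). *)

Lemma le_powRl (R : realType) (r a b : R) : 0 <= r -> 0 <= a -> a <= b -> a `^ r <= b `^ r.
Proof.
move=> r0 a0 ab; apply: ge0_ler_powR; rewrite ?nnegrE//.
exact: le_trans ab.
Qed.

Lemma le_powRNl (R : realType) (r a b : R) : 0 <= r -> 0 < a -> a <= b ->
  b `^ (- r) <= a `^ (- r).
Proof.
move=> r0 a0 ab; rewrite !powRN lef_pV2 ?posrE ?powR_gt0 ?(lt_le_trans a0)//.
by rewrite le_powRl// ltW.
Qed.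

Lemma powR_gt1 (R : realType) (r a : R) : 0 < r -> 1 < a -> 1 < a `^ r.
Proof.
move=> r0 a1; have /(_ 1 a) := @gt0_ltr_powR R r r0.
by rewrite powR1 !nnegrE; apply => //; rewrite (le_trans ler01)// ltW.
Qed.

Lemma powR_ge1 (R : realType) (r a : R) : 0 <= r -> 1 <= a -> 1 <= a `^ r.
Proof. by move=> r0 a1; rewrite -(powRr0 a) ler_powR. Qed.

(* The partial sums A_N satisfy A_N <= A_(2N+1) <= 1 + 2^(1-s) A_N. *)
Lemma sum_powRN_le (R : realType) (s : R) : 1 < s ->
  exists2 C : R, 0 < C & forall N, \sum_(0 <= i < N) (i.+1%:R : R) `^ (- s) <= C.
Proof.
move=> s1; set A := fun N : nat => \sum_(0 <= i < N) (i.+1%:R : R) `^ (- s).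
have A_ge0 N : 0 <= A N by apply: sumr_ge0 => i _; exact: powR_ge0.
set r := (2 : R) `^ (1 - s).
have r1 : r < 1.
  rewrite /r -opprB powRN invf_lt1 ?powR_gt0//.
  by rewrite powR_gt1 ?subr_gt0 ?ltr1n.
have rE : 2 * 2 `^ (- s) = r.
  by rewrite /r powRD ?pnatr_eq0 ?implybT// powRr1.
have step N : A (N.*2.+1) <= 1 + r * A N.
  elim: N => [|N IH]; first by rewrite /A big_nat1 big_geq// powR1 mulr0 addr0.
  rewrite /A doubleS 2?(big_nat_recr _.+1)//= (big_nat_recr N)//= mulrDr addrA.
  rewrite -addrA; apply: lerD => //.
  have h1 : (N.*2.+2%:R : R) `^ (- s) = 2 `^ (- s) * N.+1%:R `^ (- s).
    by rewrite -powRM ?ler0n// -natrM mul2n doubleS.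
  have h2 : (N.*2.+3%:R : R) `^ (- s) <= (N.*2.+2%:R : R) `^ (- s).
    by rewrite le_powRNl ?ltr0n ?ler_nat//; lra.
  rewrite -rE -mulrA -h1; lra.
exists (1 / (1 - r)); first by rewrite divr_gt0// subr_gt0.
move=> N; rewrite ler_pdivlMr ?subr_gt0//.
suff : A N <= A N.*2.+1 by have := step N; rewrite -/(A N); lra.
rewrite /A (@big_cat_nat _ _ _ N 0 N.*2.+1)//=; last by lia.
by rewrite lerDl; apply: sumr_ge0 => i _; exact: powR_ge0.
Qed.

Lemma geometric_sum_le (R : realFieldType) (x : R) n : 0 <= x -> x < 1 ->
  \sum_(0 <= i < n) x ^+ i <= (1 - x)^-1.
Proof.
move=> x0 x1; rewrite -[X in _ <= X]mul1r ler_pdivlMr ?subr_gt0//.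
have := subrX1 x n; rewrite -(big_mkord xpredT (fun i => x ^+ i)) => h.
by have := exprn_ge0 n x0; lra.
Qed.

(** The fractions a/(a + b) and b/(a + b) lie in [0, 1] and add up to 1; raising them to a power r
    <= 1 can only increase them. *)
Lemma powRD_le (R : realType) (r a b : R) : 0 < r <= 1 -> 0 <= a -> 0 <= b ->
  (a + b) `^ r <= a `^ r + b `^ r.
Proof.
move=> /andP[r0 r1] a0 b0.
have [/eqP ab0|ab0] := boolP (a + b == 0).
  by rewrite ab0 powR0 ?gt_eqF// addr_ge0 ?powR_ge0.
have abp : 0 < a + b by rewrite lt_neqAle eq_sym ab0 addr_ge0.
have key (x : R) : 0 <= x <= a + b -> x / (a + b) * (a + b) `^ r <= x `^ r.
  move=> /andP[x0 xab].
  rewrite -[in leRHS](divfK ab0 x) powRM ?divr_ge0 ?(ltW abp)//.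
  rewrite ler_pM2r ?powR_gt0//.
  have [->|xn0] := eqVneq x 0; first by rewrite mul0r powR_ge0.
  rewrite ger1_powR// ler_pdivrMr// mul1r xab andbT divr_gt0//.
  by rewrite lt_neqAle eq_sym xn0.
have ka : 0 <= a <= a + b by rewrite a0 lerDl.
have kb : 0 <= b <= a + b by rewrite b0 lerDr.
by have := lerD (key _ ka) (key _ kb); rewrite -mulrDl -mulrDl divff// mul1r.
Qed.

(* Up to the factor r + 1, the derivative of |x|^(r+1). *)
Definition sgpow (R : realType) (r x : R) : R := Num.sg x * `|x| `^ r.

Lemma sgpow_ge0 (R : realType) (r x : R) : 0 < r -> 0 <= x -> sgpow r x = x `^ r.
Proof.
move=> r0 x0; rewrite /sgpow; have [->|xn0] := eqVneq x 0.
  by rewrite sgr0 mul0r powR0 ?gt_eqF.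
by rewrite gtr0_sg ?lt_neqAle 1?eq_sym ?xn0// mul1r ger0_norm.
Qed.

Lemma sgpowN (R : realType) (r x : R) : sgpow r (- x) = - sgpow r x.
Proof. by rewrite /sgpow sgrN normrN mulNr. Qed.

(** For equal signs this is subadditivity of the r-th power. For opposite signs |x| and |y| are both
    at most |x - y|, whence the factor 2. *)
Lemma sgpow_hoelder (R : realType) (r x y : R) : 0 < r <= 1 ->
  `|sgpow r x - sgpow r y| <= 2 * `|x - y| `^ r.
Proof.
move=> rr; have /andP[r0 r1] := rr.
have same (u v : R) : 0 <= u -> 0 <= v -> `|sgpow r u - sgpow r v| <= `|u - v| `^ r.
  wlog uv : u v / v <= u.
    move=> H u0 v0; have [uv|/ltW uv] := leP v u; first exact: H.
    by rewrite distrC -(normrN (u - v)) opprB; exact: H.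
  move=> u0 v0; rewrite !sgpow_ge0// !ger0_norm ?subr_ge0//.
    have /(powRD_le rr) := v0; move=> /(_ (u - v)); rewrite subr_ge0 => /(_ uv).
    by rewrite addrC subrK; lra.
  by apply: ge0_ler_powR; rewrite ?nnegrE// ltW.
have opp (u v : R) : 0 <= u -> 0 <= v -> `|sgpow r u - sgpow r (- v)| <= 2 * `|u + v| `^ r.
  move=> u0 v0; rewrite sgpowN !sgpow_ge0// opprK !ger0_norm ?addr_ge0 ?powR_ge0//.
  have : u `^ r <= (u + v) `^ r.
    by rewrite le_powRl ?lerDl// ltW.
  have : v `^ r <= (u + v) `^ r.
    by rewrite le_powRl ?lerDr// ltW.
  lra.
have h (z : R) : 0 <= `|z| `^ r by exact: powR_ge0.
have [x0|/ltW x0] := leP 0 x; have [y0|/ltW y0] := leP 0 y.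
- by have := same _ _ x0 y0; have := h (x - y); lra.
- by have := opp x (- y) x0; rewrite oppr_ge0 opprK; exact.
- have := opp (- x) y; rewrite oppr_ge0 !sgpowN => /(_ x0 y0).
  rewrite -[x - y]opprK normrN opprB [- x + y]addrC.
  by rewrite -[sgpow r x - sgpow r y]opprK normrN opprB opprK [- _ + _]addrC.
- have := same (- x) (- y); rewrite !oppr_ge0 !sgpowN => /(_ x0 y0).
  by rewrite -!opprD !normrN; have := h (x - y); lra.
Qed.

(* Young's inequality is the tangent inequality for the convex function |.|^q at x + y;
   the error is then controlled by the (q-1)-Hoelder continuity of its derivative. *)
Lemma powR_normD_le (R : realType) (q x y : R) : 1 < q <= 2 ->
  `|x + y| `^ q <= `|x| `^ q + q * (sgpow (q - 1) x * y) + 2 * q * `|y| `^ q.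
Proof.
move=> /andP[q1 q2]; set r := q - 1; have r0 : 0 < r by rewrite /r; lra.
have q0 : 0 < q by lra.
have tangent (u z : R) : `|z| `^ q + q * (sgpow r z * (u - z)) <= `|u| `^ q.
  have zz : sgpow r z * z = `|z| `^ q.
    have [->|zn0] := eqVneq z 0; first by rewrite mulr0 normr0 powR0 ?gt_eqF.
    rewrite /sgpow mulrAC -normrEsg -[X in X * _ = _]powRr1// -powRD.
      by rewrite /r; congr (_ `^ _); lra.
    by rewrite normr_eq0 zn0 implybT.
  have : sgpow r z * u <= `|z| `^ r * `|u|.
    apply: (le_trans (ler_norm _)); rewrite normrM ler_wpM2r// /sgpow.
    rewrite normrM normr_sg norm_powR// normr_id.
    by case: (z != 0); rewrite ?mul1r// mul0r powR_ge0.
  (* Young with the conjugate exponents q/(q - 1) and q, which turn |z|^(q-1) into |z|^q. *)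
  have := @conjugate_powR R (`|z| `^ r) `|u| (q / r) q.
  rewrite powR_ge0 normr_ge0 => /(_ isT isT); rewrite divr_gt0// => /(_ isT q0).
  have -> : (q / r)^-1 + q^-1 = 1 by rewrite /r; field; rewrite -/r !gt_eqF.
  move=> /(_ erefl).
  rewrite -powRrM [r * _]mulrC divfK ?gt_eqF//.
  have -> : `|z| `^ q / (q / r) = `|z| `^ q - `|z| `^ q / q.
    by rewrite /r; field; rewrite -/r ?gt_eqF.
  move=> H1 H2; rewrite mulrBr zz.
  have : q * (sgpow r z * u) <= q * (`|z| `^ q - `|z| `^ q / q + `|u| `^ q / q).
    by rewrite ler_pM2l//; rewrite mulrC in H1; lra.
  have -> : q * (`|z| `^ q - `|z| `^ q / q + `|u| `^ q / q) =
    q * `|z| `^ q - `|z| `^ q + `|u| `^ q by field; rewrite gt_eqF.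
  lra.
have := tangent x (x + y).
have -> : x - (x + y) = - y by ring.
have : (sgpow r (x + y) - sgpow r x) * y <= 2 * `|y| `^ q.
  apply: (le_trans (ler_norm _)); rewrite normrM.
  have -> : `|y| `^ q = `|y| `^ r * `|y|.
    by rewrite mulrC mulr_powRB1.
  rewrite mulrA ler_wpM2r//.
  have := @sgpow_hoelder R r (x + y) x; rewrite r0 [x + y]addrC addrK; apply.
  by rewrite /r; lra.
rewrite -(ler_pM2l q0); lra.
Qed.

(* Optimizing s gives E|u|^q <= 2 (E u^2)^(q/2), without appealing to Jensen. *)
Lemma powR_norm_le_sqr (R : realType) (q s u : R) : 0 < s -> 0 < q <= 2 ->
  `|u| `^ q <= s `^ q + s `^ (q - 2) * u ^+ 2.
Proof.
move=> s0 /andP[q0 q2]; have [us|su] := leP `|u| s.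
  rewrite (@le_trans _ _ (s `^ q))//.
    by rewrite le_powRl// ltW.
  by rewrite lerDl mulr_ge0 ?powR_ge0 ?sqr_ge0.
have u0 : 0 < `|u| by apply: lt_trans su.
rewrite (@le_trans _ _ (s `^ (q - 2) * u ^+ 2))//; last by rewrite lerDr powR_ge0.
have -> : `|u| `^ q = `|u| `^ (q - 2) * u ^+ 2.
  rewrite -real_normK ?num_real// -powR_mulrn// -powRD ?subrK//.
  by rewrite gt_eqF ?implybT.
rewrite ler_wpM2r ?sqr_ge0//.
by rewrite -[q - 2]opprK le_powRNl ?(ltW su)//; lra.
Qed.

Lemma powR_normD_le2 (R : realType) (q x y : R) : 0 < q <= 2 ->
  `|x + y| `^ q <= 4 * (`|x| `^ q + `|y| `^ q).
Proof.
move=> /andP[q0 q2].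
wlog xy : x y / `|y| <= `|x|.
  by move=> H; have [/H//|/ltW/H] := leP `|y| `|x|; rewrite addrC [in leRHS]addrC.
have : `|x + y| <= 2 * `|x| by rewrite (le_trans (ler_normD _ _))//; lra.
move=> /(le_powRl (ltW q0) (normr_ge0 _)) H.
rewrite (le_trans H)// powRM//.
have h4 : (2 : R) `^ q <= 4.
  rewrite (@le_trans _ _ (2 `^ 2%:R))//; first by rewrite ler_powR// ler1n.
  by rewrite powR_mulrn//; lra.
have := powR_ge0 `|x| q; have := powR_ge0 `|y| q => hy hx.
rewrite (@le_trans _ _ (4 * `|x| `^ q))//; first by rewrite ler_wpM2r.
lra.
Qed.

(** * Dyadic chaining and autocorrelations *)

(* [0, n) is a disjoint union of the dyadic blocks given by the binary expansion of n; the
   factor n^eps absorbs their number. *)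
Lemma dyadic_chaining (R : realType) (Z : nat -> R) (tau eps H : R) :
  0 < eps -> 0 <= tau -> 0 <= H ->
  (forall l b, `|\sum_(b * 2 ^ l <= k < b.+1 * 2 ^ l) Z k| <=
     H * ((b.+1 * 2 ^ l)%:R : R) `^ tau) ->
  exists C : R, forall n, `|\sum_(0 <= k < n) Z k| <= C * n%:R `^ (tau + eps).
Proof.
move=> e0 t0 H0 hZ; set g := (2 : R) `^ eps - 1.
have g0 : 0 < g.
  by rewrite /g subr_gt0 powR_gt1// ltr1n.
(* K pays for one more block at each doubling: K (2^eps - 1) >= 1 serves n' > 0, and K >= 1 serves
   n' = 0. *)
set K := 1 + g^-1; have K1 : 1 <= K by rewrite /K lerDl invr_ge0 ltW.
have Kg : 1 <= K * g by rewrite /K mulrDl mulVf ?gt_eqF// lerDr mulr_ge0// ltW.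
(* Strong induction on n, for all scales at once: n blocks of length 2^l are n/2 blocks of length
   2^(l+1), followed by a single block of length 2^l if n is odd. *)
have claim n : forall l, `|\sum_(0 <= k < n * 2 ^ l) Z k| <=
    H * (n * 2 ^ l)%:R `^ tau * (K * n%:R `^ eps).
  elim/ltn_ind: n => n IH l.
  have [->|n0] := posnP n.
    rewrite mul0n big_geq// normr0 !mulr_ge0 ?powR_ge0//; lra.
  set n' := n./2.
  have n'n : (n' < n)%N by rewrite /n'; lia.
  have nE : n = (n'.*2 + odd n)%N by rewrite addnC odd_double_half.
  have n2E : (n' * 2 ^ l.+1 = n'.*2 * 2 ^ l)%N by rewrite expnS mulnA muln2.
  have hb : `|\sum_(n' * 2 ^ l.+1 <= k < n * 2 ^ l) Z k| <= H * (n * 2 ^ l)%:R `^ tau.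
    rewrite n2E; case: (odd n) nE => /= [|]; rewrite ?addn1 ?addn0 => nE.
      by rewrite [in X in index_iota _ X]nE [in X in _ <= X]nE.
    by rewrite [in X in index_iota _ X]nE big_geq// normr0 mulr_ge0 ?powR_ge0.
  rewrite (@big_cat_nat _ _ _ (n' * 2 ^ l.+1) 0)//=; last first.
    by rewrite n2E leq_mul2r; apply/orP; right; rewrite [leqRHS]nE leq_addr.
  have ha : `|\sum_(0 <= k < n' * 2 ^ l.+1) Z k| <=
      H * (n * 2 ^ l)%:R `^ tau * (K * n'%:R `^ eps).
    apply: (le_trans (IH _ n'n l.+1)); rewrite ler_wpM2r//.
      by rewrite mulr_ge0 ?powR_ge0//; lra.
    rewrite ler_wpM2l// le_powRl ?ler0n// ler_nat n2E leq_mul2r.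
    by apply/orP; right; rewrite [leqRHS]nE leq_addr.
  apply: (le_trans (ler_normD _ _)).
  have hc : K * n'%:R `^ eps + 1 <= K * n%:R `^ eps.
    have [n'0|n'0] := posnP n'.
      rewrite n'0 powR0 ?gt_eqF// mulr0 add0r.
      have : (1 : R) <= n%:R `^ eps.
        by rewrite powR_ge1 ?ler1n// ltW.
      nra.
    have h1 : 2 `^ eps * n'%:R `^ eps <= n%:R `^ eps.
      rewrite -powRM// le_powRl ?(ltW e0) ?mulr_ge0 ?ler0n// -natrM ler_nat.
      by rewrite mul2n [leqRHS]nE leq_addr.
    have h2 : (1 : R) <= n'%:R `^ eps.
      by rewrite powR_ge1 ?ler1n// ltW.
    have h3 : 1 <= K * g * n'%:R `^ eps.
      by rewrite -[X in X <= _]mulr1 ler_pM.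
    have h4 : K * (2 `^ eps * n'%:R `^ eps) <= K * n%:R `^ eps.
      by rewrite ler_wpM2l//; lra.
    have h5 : K * g * n'%:R `^ eps =
      K * (2 `^ eps * n'%:R `^ eps) - K * n'%:R `^ eps by rewrite /g; ring.
    lra.
  have := ler_wpM2l (mulr_ge0 H0 (powR_ge0 ((n * 2 ^ l)%:R : R) tau)) hc.
  rewrite mulrDr mulr1; lra.
exists (H * K) => n; have := claim n 0%N; rewrite expn0 muln1.
move=> /le_trans; apply; rewrite -[X in _ <= X]mulrA powRD.
  by rewrite [X in X <= _](_ : _ = H * (K * (n%:R `^ tau * n%:R `^ eps)))//; ring.
by rewrite gt_eqF// ltr_wpDl.
Qed.

(* The shift by one makes the bound cover l = 0, about which the hypothesis is void. *)
Lemma coeff_decay (R : realType) (sigma M : R) (c : nat -> R) : 0 < sigma <= 1 ->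
  (forall l : nat, l%:R `^ sigma * `|c l| <= M) ->
  exists2 M' : R, 0 <= M' & forall l, `|c l| <= M' * (l.+1%:R `^ (- sigma)).
Proof.
move=> /andP[s0 s1] cM; exists (`|c 0%N| + 2 * `|M|); first by rewrite addr_ge0// mulr_ge0.
move=> l; rewrite powRN ler_pdivlMr ?powR_gt0 ?ltr0n//.
case: l => [|l]; first by rewrite powR1 mulr1 lerDl mulr_ge0.
have h : (l.+2%:R : R) `^ sigma <= 2 * l.+1%:R `^ sigma.
  rewrite (@le_trans _ _ ((2 * l.+1%:R) `^ sigma))//.
    by rewrite le_powRl ?(ltW s0) ?ler0n// -natrM ler_nat; lia.
  rewrite powRM ?ler0n// ler_wpM2r ?powR_ge0//.
  by rewrite ler1_powR// ler1n.
rewrite mulrC (le_trans (ler_wpM2r (normr_ge0 _) h))//.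
by rewrite -mulrA (le_trans (ler_wpM2l _ (cM l.+1)))//; have := ler_norm M; have := normr_ge0 (c 0%N); lra.
Qed.

(* (i + t + 1)^-sigma is split as (t + 1)^-kappa (i + 1)^-(sigma - kappa). *)
Lemma autocorrelation_le (R : realType) (sigma kappa M : R) (c : nat -> R) :
  0 <= kappa -> kappa <= sigma -> 1 < 2 * sigma - kappa -> 0 <= M ->
  (forall l, `|c l| <= M * (l.+1%:R `^ (- sigma))) ->
  exists2 C : R, 0 <= C & forall N t,
    \sum_(0 <= i < N) `|c i * c (i + t)%N| <= C * t.+1%:R `^ (- kappa).
Proof.
move=> k0 ks s2 M0 cM; have [C C0 hC] := sum_powRN_le s2.
exists (M ^+ 2 * C); first by rewrite mulr_ge0 ?sqr_ge0// ltW.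
move=> N t; rewrite -mulrA [C * _]mulrC mulrA.
apply: le_trans (ler_wpM2l _ (hC N)); last by rewrite mulr_ge0 ?sqr_ge0 ?powR_ge0.
rewrite mulr_sumr; apply: ler_sum => i _; rewrite normrM.
have h1 : ((i + t).+1%:R : R) `^ (- sigma) <= t.+1%:R `^ (- kappa) * i.+1%:R `^ (- (sigma - kappa)).
  rewrite (_ : - sigma = - kappa + - (sigma - kappa)); last by ring.
  rewrite powRD ?pnatr_eq0 ?implybT// ler_pM ?powR_ge0// //.
    by rewrite le_powRNl ?ltr0n// ler_nat; lia.
  by rewrite le_powRNl ?ltr0n ?subr_ge0// ler_nat; lia.
have h2 : (i.+1%:R : R) `^ (- (2 * sigma - kappa)) = i.+1%:R `^ (- sigma) * i.+1%:R `^ (- (sigma - kappa)).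
  by rewrite -powRD ?pnatr_eq0 ?implybT//; congr (_ `^ _); ring.
apply: (le_trans (ler_pM _ _ (cM i) (cM (i + t)%N))) => //.
rewrite h2 [X in _ <= X](_ : _ = M * i.+1%:R `^ (- sigma) * (M * (t.+1%:R `^ (- kappa) * i.+1%:R `^ (- (sigma - kappa))))); last by ring.
by rewrite ler_wpM2l ?mulr_ge0 ?powR_ge0// ler_wpM2l.
Qed.

(** This is |k - l|, as at least one of the truncated differences vanishes. *)
Definition dist (k l : nat) := (k - l + (l - k))%N.

(** Each distance below m is attained at most twice, once on either side of k. *)
Lemma sum_dist_le (R : realDomainType) (f : nat -> R) k m : (forall t, 0 <= f t) ->
  (k < m)%N -> \sum_(0 <= l < m) f (dist k l) <= 2 * \sum_(0 <= t < m) f t.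
Proof.
move=> f0 km; rewrite (@big_cat_nat _ _ _ k.+1)//= mulr2n mulrDl mul1r lerD//.
  rewrite (@big_cat_nat _ _ _ k.+1 _ m)//= [X in X <= _](_ : _ = \sum_(0 <= i < k.+1) f i).
    by rewrite lerDl sumr_ge0.
  rewrite big_nat_rev /=; apply: eq_big_nat => i /andP[_ ik]; congr f.
  by rewrite /dist; lia.
rewrite [X in X <= _](_ : _ = \sum_(0 <= i < m - k.+1) f i.+1).
  rewrite -(big_add1 _ _ 0 (m - k.+1).+1 xpredT f) (@big_cat_nat _ _ _ (m - k.+1).+1 0 m)//=; last by lia.
  rewrite [X in _ <= X + _]big_ltn//.
  have : 0 <= \sum_((m - k.+1).+1 <= i < m) f i by apply: sumr_ge0.
  by have := f0 0%N; lra.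
rewrite -{1}[k.+1]add0n big_addn; apply: eq_big_nat => i /andP[_ ik]; congr f.
by rewrite /dist; lia.
Qed.

(** For t < m the factor (t+1)^beta is at most m^beta; extracting it makes the remaining series in t
    converge. Each of the m rows thus costs O(m^beta). *)
Lemma double_sum_dist_le (R : realType) (kappa beta : R) : 0 <= beta -> 1 < 2 * kappa + beta ->
  exists2 C : R, 0 <= C & forall m : nat,
    \sum_(0 <= k < m) \sum_(0 <= l < m) ((dist k l).+1%:R `^ (- kappa)) ^+ 2 <= C * m%:R `^ (1 + beta).
Proof.
move=> b0 kb; have [C C0 hC] := sum_powRN_le kb.
exists (2 * C) => [|m]; first by rewrite mulr_ge0// ltW.
set f := fun t : nat => ((t.+1%:R : R) `^ (- kappa)) ^+ 2.
have fE t : (t < m)%N -> f t <= m%:R `^ beta * t.+1%:R `^ (- (2 * kappa + beta)).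
  move=> tm; rewrite (_ : f t = t.+1%:R `^ beta * t.+1%:R `^ (- (2 * kappa + beta))).
    rewrite ler_wpM2r ?powR_ge0// le_powRl ?ler0n// ler_nat; lia.
  rewrite /f -powR_mulrn ?powR_ge0// -powRrM -powRD ?pnatr_eq0 ?implybT//.
  by congr (_ `^ _); ring.
have hf : \sum_(0 <= t < m) f t <= C * m%:R `^ beta.
  rewrite mulrC; apply: le_trans (ler_wpM2l (powR_ge0 _ _) (hC m)).
  rewrite mulr_sumr !big_nat; apply: ler_sum => t /andP[_ tm]; exact: fE.
apply: (@le_trans _ _ (\sum_(0 <= k < m) (2 * (C * m%:R `^ beta)))).
  rewrite !big_nat; apply: ler_sum => k /andP[_ km].
  apply: (le_trans (sum_dist_le (f := f) _ km)); first by move=> t; rewrite /f sqr_ge0.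
  by rewrite ler_wpM2l.
rewrite sumr_const_nat subn0 -[X in X <= _]mulr_natr powRD ?powRr1 ?ler0n//.
  by rewrite [X in X <= _](_ : _ = 2 * C * (m%:R * m%:R `^ beta))//; ring.
by rewrite gt_eqF//; lra.
Qed.

(* The coefficient of xi_n in X_K = sum_(n <= K) c_(K - n) xi_n. *)
Definition shift_coeff (R : nmodType) (c : nat -> R) (K n : nat) : R :=
  if (n <= K)%N then c (K - n)%N else 0.

(** Substituting i = K - u gives a partial autocorrelation at lag J - K. The bound depends only on
    the lag, which later makes block bounds uniform in the position. *)
Lemma shift_coeff_corr (R : realType) (c : nat -> R) (C kappa : R) K J L :
  (forall N t, \sum_(0 <= i < N) `|c i * c (i + t)%N| <= C * t.+1%:R `^ (- kappa)) ->
  (K < L)%N -> (J < L)%N ->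
  `|\sum_(0 <= u < L) shift_coeff c K u * shift_coeff c J u| <= C * (dist K J).+1%:R `^ (- kappa).
Proof.
move=> hC; wlog KJ : K J / (K <= J)%N.
  move=> H KL JL; have [KJ|/ltnW KJ] := leqP K J; first exact: H.
  under eq_bigr do rewrite mulrC.
  by rewrite /dist addnC; exact: H.
move=> KL JL; apply: (le_trans (ler_norm_sum _ _ _)).
rewrite (@big_cat_nat _ _ _ K.+1)//= [X in _ + X]big1_seq ?addr0; last first.
  move=> i /andP[_]; rewrite mem_index_iota => /andP[Ki _].
  by rewrite /shift_coeff leqNgt Ki /= mul0r normr0.
apply: le_trans (hC K.+1 _); rewrite big_nat_rev /= le_eqVlt; apply/orP; left; apply/eqP.
apply: eq_big_nat => i /andP[_ iK]; rewrite /shift_coeff !ifT; [|lia..].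
by congr (`| c _ * c _|); rewrite /dist; lia.
Qed.

(** * Independence *)

Section indep_prod.
Context d d1 d2 (T : measurableType d) (T1 : measurableType d1) (T2 : measurableType d2).
Context (R : realType) (P : probability T R) (X1 : T -> T1) (X2 : T -> T2).
Hypotheses (mX1 : measurable_fun setT X1) (mX2 : measurable_fun setT X2).
Hypothesis ind : forall A B, measurable A -> measurable B ->
  P (X1 @^-1` A `&` X2 @^-1` B) = (P (X1 @^-1` A) * P (X2 @^-1` B))%E.

Let mX : measurable_fun setT (fun w => (X1 w, X2 w)).
Proof. exact: measurable_fun_pair. Qed.
Let X1_mixin := isMeasurableFun.Build _ _ _ _ _ mX1.
Let X1' : {mfun T >-> T1} := HB.pack X1 X1_mixin.
Let X2_mixin := isMeasurableFun.Build _ _ _ _ _ mX2.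
Let X2' : {mfun T >-> T2} := HB.pack X2 X2_mixin.
Let X_mixin := isMeasurableFun.Build _ _ _ _ _ mX.
Let X' : {mfun T >-> (T1 * T2)%type} := HB.pack (fun w => (X1 w, X2 w)) X_mixin.

(** Independence says that the joint law and the product of the marginals agree on rectangles, and
    these determine the product measure. *)
Let distE A : measurable A ->
  (distribution P X1' \x distribution P X2')%E A = distribution P X' A.
Proof.
apply: product_measure_unique => {}A B mA mB.
exact: ind.
Qed.

Lemma indep_integral_prod_ge0 (f1 : T1 -> \bar R) (f2 : T2 -> \bar R) :
  measurable_fun setT f1 -> measurable_fun setT f2 ->
  (forall x, 0 <= f1 x)%E -> (forall x, 0 <= f2 x)%E ->
  (\int[P]_w (f1 (X1 w) * f2 (X2 w)) = \int[P]_w f1 (X1 w) * \int[P]_w f2 (X2 w))%E.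
Proof.
move=> mf1 mf2 f10 f20.
have mf : measurable_fun setT (fun z : T1 * T2 => (f1 z.1 * f2 z.2)%E).
  by apply: emeasurable_funM; apply: measurableT_comp.
transitivity (\int[distribution P X']_z (f1 z.1 * f2 z.2))%E.
  by rewrite ge0_integral_distribution//= => z; exact: mule_ge0.
transitivity (\int[distribution P X1' \x distribution P X2']_z (f1 z.1 * f2 z.2))%E.
  by apply: eq_measure_integral => A mA _; exact/esym/distE.
rewrite fubini_tonelli1//=; last by move=> z; exact: mule_ge0.
rewrite /fubini_F /=.
under eq_integral do rewrite ge0_integralZl//.
rewrite ge0_integralZr//; last by apply: integral_ge0.
by rewrite !ge0_integral_distribution.
Qed.

Lemma indep_integrable_prod (g1 : T1 -> R) (g2 : T2 -> R) :
  measurable_fun setT g1 -> measurable_fun setT g2 ->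
  P.-integrable setT (fun w => (g1 (X1 w))%:E) -> P.-integrable setT (fun w => (g2 (X2 w))%:E) ->
  P.-integrable setT (fun w => (g1 (X1 w) * g2 (X2 w))%:E).
Proof.
move=> mg1 mg2 /integrableP[_ i1] /integrableP[_ i2]; apply/integrableP; split.
  by apply/measurable_EFinP; apply: measurable_funM; apply: measurableT_comp.
have h : (\int[P]_w (`|(g1 (X1 w))%:E| * `|(g2 (X2 w))%:E|) =
    \int[P]_w `|(g1 (X1 w))%:E| * \int[P]_w `|(g2 (X2 w))%:E|)%E.
  apply: (indep_integral_prod_ge0 (f1 := fun x => `|(g1 x)%:E|%E) (f2 := fun x => `|(g2 x)%:E|%E)) => //;
    by apply: measurableT_comp => //; apply/measurable_EFinP.
under eq_integral do rewrite EFinM abseM.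
by rewrite h lte_mul_pinfty// ?integral_ge0// ge0_fin_numE ?integral_ge0.
Qed.

Lemma indep_integral_prod (g1 : T1 -> R) (g2 : T2 -> R) :
  measurable_fun setT g1 -> measurable_fun setT g2 ->
  P.-integrable setT (fun w => (g1 (X1 w))%:E) -> P.-integrable setT (fun w => (g2 (X2 w))%:E) ->
  (\int[P]_w (g1 (X1 w) * g2 (X2 w))%:E = \int[P]_w (g1 (X1 w))%:E * \int[P]_w (g2 (X2 w))%:E)%E.
Proof.
move=> mg1 mg2 i1 i2.
pose g (z : T1 * T2) := (g1 z.1 * g2 z.2)%:E.
have mg : measurable_fun setT g.
  by apply/measurable_EFinP; apply: measurable_funM; apply: measurableT_comp.
have ig : (distribution P X').-integrable setT g.
  apply: integrable_pushforward => //=; exact: indep_integrable_prod.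
have ig1 : (distribution P X1').-integrable setT (EFin \o g1).
  by apply: integrable_pushforward => //=; apply/measurable_EFinP.
have ig2 : (distribution P X2').-integrable setT (EFin \o g2).
  by apply: integrable_pushforward => //=; apply/measurable_EFinP.
have ig' : (distribution P X1' \x distribution P X2')%E.-integrable setT g.
  move/integrableP : ig => [_ ig]; apply/integrableP; split=> //.
  by rewrite (eq_measure_integral (distribution P X'))// => A mA _; exact: distE.
transitivity (\int[distribution P X']_z g z)%E.
  by rewrite integral_pushforward//=; exact: indep_integrable_prod.
transitivity (\int[distribution P X1' \x distribution P X2']_z g z)%E.
  by apply: eq_measure_integral => A mA _; exact/esym/distE.
rewrite -integral12_prod_meas1//= /fubini_F /g /=.
under eq_integral do under eq_integral do rewrite EFinM.
under eq_integral do rewrite integralZl//.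
have E1 : (\int[distribution P X1']_x (g1 x)%:E = \int[P]_w (g1 (X1 w))%:E)%E.
  by rewrite integral_pushforward//=; exact/measurable_EFinP.
have E2 : (\int[distribution P X2']_x (g2 x)%:E = \int[P]_w (g2 (X2 w))%:E)%E.
  by rewrite integral_pushforward//=; exact/measurable_EFinP.
rewrite E2 -E1 -[X in (_ * X)%E]fineK; last exact: integrable_fin_num.
rewrite -integralZr//.
by apply: eq_integral => y _; rewrite fineK//; exact: integrable_fin_num.
Qed.
End indep_prod.

Section past.
Context d (T : measurableType d) (R : realType) (P : probability T R) (xi : nat -> T -> R).
Hypothesis mxi : forall j, measurable_fun setT (xi j).
Hypothesis ind : mutually_independent P xi.

(* A pi-system generating the sigma-algebra of xi_0, ..., xi_(n-1). *)
Definition past (n : nat) : set (set T) :=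
  [set A | exists2 B : nat -> set R, (forall i, measurable (B i)) &
    A = [set w | forall i, (i < n)%N -> B i (xi i w)]].

(** The same points with a smaller sigma-algebra: being determined by the past is measurability out
    of [pastT n], and the identity into it is a random variable to which the independence lemmas
    apply. *)
Definition pastT n := g_sigma_algebraType (past n).

Lemma past_measurable n : past n `<=` measurable.
Proof.
move=> _ [B mB ->].
rewrite (_ : mkset _ = \bigcap_(i in `I_n) (xi i @^-1` B i)); last first.
  by apply/seteqP; split => w /=.
apply: bigcap_measurableType => // i _.
by rewrite -[X in measurable X]setTI; exact: mxi.
Qed.

Lemma measurable_past_id n : measurable_fun setT (id : T -> pastT n).
Proof.
move=> _ A mA; rewrite setTI preimage_id.
apply: smallest_sub mA; first exact: sigma_algebra_measurable.
exact: past_measurable.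
Qed.

Lemma measurable_past_xi n i : (i < n)%N -> measurable_fun setT (xi i : pastT n -> R).
Proof.
move=> iN _ A mA; apply: sub_sigma_algebra; rewrite setTI.
exists (fun j => if j == i then A else setT); first by move=> j; case: ifP.
apply/seteqP; split => w /=.
  by move=> Aw j jn; case: eqP => // ->.
by move=> /(_ _ iN); rewrite eqxx.
Qed.

(** As functions of A both sides are finite measures, P restricted to the event that xi_n lies in B
    and a multiple of P; on the pi-system they agree by mutual independence of xi_0, ..., xi_n. *)
Lemma past_indep n A B : <<s past n >> A -> measurable B ->
  P (A `&` xi n @^-1` B) = (P A * P (xi n @^-1` B))%E.
Proof.
move=> pA mB.
have mC : measurable (xi n @^-1` B) by rewrite -[X in measurable X]setTI; exact: mxi.
have PC : P (xi n @^-1` B) \is a fin_num by exact: fin_num_measure.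
have C0 : 0 <= fine (P (xi n @^-1` B)) by exact: fine_ge0.
pose m2 := mscale (NngNum C0) P.
rewrite -(fineK PC) muleC.
rewrite -[RHS]/(m2 A).
rewrite -[LHS]/(mrestr P mC A).
apply: (g_sigma_algebra_measure_unique (past n) _ (fun=> setT)) => //.
- exact: past_measurable.
- by move=> _; exists (fun=> setT) => //; apply/seteqP; split => w.
- by rewrite bigcup_const.
- move=> _ _ [B1 mB1 ->] [B2 mB2 ->]; exists (fun i => B1 i `&` B2 i).
    by move=> i; exact: measurableI.
  apply/seteqP; split => w /=; first by move=> [h1 h2] i ni; split; [exact: h1|exact: h2].
  by move=> h; split => i /h[].
- move=> _ [B1 mB1 ->].
  rewrite -[RHS]/((fine (P (xi n @^-1` B)))%:E * P [set w | forall i, (i < n)%N -> B1 i (xi i w)])%E.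
  rewrite -[LHS]/(P ([set w | forall i, (i < n)%N -> B1 i (xi i w)] `&` xi n @^-1` B)).
  rewrite fineK//.
  pose B2 i := if i == n then B else B1 i.
  have mB2 i : i \in n :: iota 0 n -> measurable (B2 i) by rewrite /B2; case: ifP.
  have un : uniq (n :: iota 0 n) by rewrite /= iota_uniq mem_iota ltnn.
  have := ind un mB2.
  have := ind (iota_uniq 0 n) (fun i _ => mB1 i).
  rewrite big_cons (_ : [set w | B2 n (xi n w)] = xi n @^-1` B); last by rewrite /B2 eqxx.
  rewrite (_ : (\prod_(i <- iota 0 n) P [set w | B2 i (xi i w)] =
    \prod_(i <- iota 0 n) P [set w | B1 i (xi i w)])%E); last first.
    by apply: eq_big_seq => i; rewrite mem_iota add0n => /andP[_ ni]; rewrite /B2 ltn_eqF.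
  move=> <-.
  rewrite (_ : [set w | forall i, i \in iota 0 n -> B1 i (xi i w)] = [set w | forall i, (i < n)%N -> B1 i (xi i w)]); last first.
    by apply/seteqP; split => w /= h i; have := h i; rewrite mem_iota.
  move=> <-; congr (P _); apply/seteqP; split => w /=.
    move=> [h1 h2] i; rewrite inE mem_iota /B2; case: eqVneq => [->//|_ /=].
    exact: h1.
  move=> h; split.
    move=> i ni; have := h i; rewrite inE mem_iota /= ni orbT /B2 ltn_eqF//.
    exact.
  by have := h n; rewrite inE eqxx /B2 eqxx; exact.
- move=> _; apply: (@le_lt_trans _ _ 1%E); last exact: ltry.
  rewrite -[X in (X <= _)%E]/(P (setT `&` xi n @^-1` B)) setTI.
  exact: probability_le1.
Qed.
Lemma past_integrable_prod n (g : T -> R) (f : R -> R) :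
  measurable_fun setT (g : pastT n -> R) -> measurable_fun setT f ->
  P.-integrable setT (fun w => (g w)%:E) -> P.-integrable setT (fun w => (f (xi n w))%:E) ->
  P.-integrable setT (fun w => (g w * f (xi n w))%:E).
Proof.
move=> mg mf ig if_.
apply: (@indep_integrable_prod _ _ _ T (pastT n) R R P id (xi n)) => //.
  exact: measurable_past_id.
by move=> A B mA mB; exact: past_indep.
Qed.

(** This takes the place of conditional expectations: a mean-zero function of xi_n is orthogonal to
    everything determined by the past. *)
Lemma past_integral_prod n (g : T -> R) (f : R -> R) :
  measurable_fun setT (g : pastT n -> R) -> measurable_fun setT f ->
  P.-integrable setT (fun w => (g w)%:E) -> P.-integrable setT (fun w => (f (xi n w))%:E) ->
  (\int[P]_w (g w * f (xi n w))%:E = \int[P]_w (g w)%:E * \int[P]_w (f (xi n w))%:E)%E.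
Proof.
move=> mg mf ig if_.
apply: (@indep_integral_prod _ _ _ T (pastT n) R R P id (xi n)) => //.
  exact: measurable_past_id.
by move=> A B mA mB; exact: past_indep.
Qed.

End past.

(** * Moments of linear and quadratic forms *)

Lemma measurable_sgpow (R : realType) (r : R) : 0 < r -> measurable_fun setT (sgpow r).
Proof.
move=> r0; rewrite (_ : sgpow r = fun x : R => (Order.max x 0) `^ r - (Order.max (- x) 0) `^ r).
  apply: measurable_funB.
    by apply: (measurableT_comp (measurable_powR _)); apply: measurable_maxr.
  apply: (measurableT_comp (measurable_powR _)); apply: measurable_maxr => //.
apply/funext => x; have [x0|/ltW x0] := leP 0 x.
  by rewrite sgpow_ge0// (@max_r _ _ (- x)) ?oppr_le0// powR0 ?gt_eqF// subr0.
rewrite -[in LHS](opprK x) sgpowN sgpow_ge0 ?oppr_ge0//.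
by rewrite (@max_l _ _ (- x)) ?oppr_ge0// powR0 ?gt_eqF// sub0r.
Qed.

Lemma probability_integral_cst d (T : measurableType d) (R : realType) (P : probability T R)
  (r : \bar R) : (\int[P]_w r = r)%E.
Proof.
transitivity (r * P setT)%E; first exact: integral_cst.
by rewrite probability_setT mule1.
Qed.

Lemma integrable_le_EFin d (T : measurableType d) (R : realType) (P : {measure set T -> \bar R})
  (f g : T -> R) : measurable_fun setT f -> (forall w, `|f w| <= g w) ->
  P.-integrable setT (fun w => (g w)%:E) -> P.-integrable setT (fun w => (f w)%:E).
Proof.
move=> mf fg ig; apply: le_integrable ig => //; first exact/measurable_EFinP.
move=> w _ /=; rewrite lee_fin (le_trans (fg w))//; exact: ler_norm.
Qed.

Section moments.
Context d (T : measurableType d) (R : realType) (P : probability T R) (xi : nat -> T -> R).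
Hypothesis mxi : forall j, measurable_fun setT (xi j).
Hypothesis ind : mutually_independent P xi.

Lemma past_measurableT n (f : T -> R) :
  measurable_fun setT (f : pastT xi n -> R) -> measurable_fun setT f.
Proof.
move=> mf; have mid := measurable_past_id mxi (n:=n).
by move=> _ A mA; have := mid measurableT _ (mf measurableT _ mA); rewrite !setTI.
Qed.

(* von Bahr--Esseen: in the expansion of |S + y|^q the term linear in y has mean 0. *)
Lemma sum_moment_le (q K : R) (f : R -> R) (a : nat -> R) n : 1 < q <= 2 ->
  measurable_fun setT f ->
  (forall j, P.-integrable setT (fun w => (f (xi j w))%:E)) ->
  (forall j, \int[P]_w (f (xi j w))%:E = 0)%E ->
  (forall j, \int[P]_w (`|f (xi j w)| `^ q)%:E <= K%:E)%E ->
  (\int[P]_w (`|\sum_(0 <= j < n) a j * f (xi j w)| `^ q)%:E <=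
    (2 * q * K * \sum_(0 <= j < n) `|a j| `^ q)%:E)%E.
Proof.
move=> q12; have /andP[q1 q2] := q12; move=> mf i_f f0 fK.
have q0 : 0 < q by lra.
set S := fun n w => \sum_(0 <= j < n) a j * f (xi j w).
have mS m : measurable_fun setT (S m : pastT xi m -> R).
  rewrite /S; under eq_fun do rewrite big_mkord.
  apply: measurable_sum => i; apply: measurable_funM => //.
  by apply: measurableT_comp => //; exact: measurable_past_xi.
have mS' m := past_measurableT (mS m).
have mf' j : measurable_fun setT (fun w => f (xi j w)) by exact: measurableT_comp.
have mq : measurable_fun setT (fun x : R => `|x| `^ q).
  by apply: (measurableT_comp (measurable_powR _)); exact: normr_measurable.
have iS m : P.-integrable setT (fun w => (S m w)%:E).
  rewrite /S; under eq_fun do rewrite -sumEFin.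
  apply: integrable_sum => // i _.
  by under eq_fun do rewrite EFinM; apply: integrableZl.
elim: n => [|n IH].
  under eq_integral do rewrite big_geq// normr0 powR0 ?gt_eqF//.
  by rewrite integral0 big_geq// mulr0.
have i1 : P.-integrable setT (fun w => (`|S n w| `^ q)%:E).
  apply/integrableP; split.
    by apply/measurable_EFinP; exact: (measurableT_comp mq).
  under eq_integral do rewrite gee0_abs ?lee_fin ?powR_ge0//.
  by apply: le_lt_trans IH _; rewrite ltry.
have i2 : P.-integrable setT (fun w => (`|a n * f (xi n w)| `^ q)%:E).
  under eq_fun do rewrite normrM powRM// EFinM.
  apply: integrableZl => //; apply/integrableP; split.
    by apply/measurable_EFinP; exact: (measurableT_comp mq).
  under eq_integral do rewrite gee0_abs ?lee_fin ?powR_ge0//.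
  by apply: le_lt_trans (fK n) _; rewrite ltry.
have r0 : 0 < q - 1 by lra.
have mpsi : measurable_fun setT (fun w => sgpow (q - 1) (S n w) * a n : R).
  by apply: measurable_funM => //; apply: (measurableT_comp (measurable_sgpow r0)).
have mpsi' : measurable_fun setT ((fun w => sgpow (q - 1) (S n w) * a n : R) : pastT xi n -> R).
  by apply: measurable_funM => //; apply: (measurableT_comp (measurable_sgpow r0)).
(* As 0 < q - 1 <= 1, |S|^(q-1) <= 1 + |S|, so the integrability of S is enough. *)
have ipsi : P.-integrable setT (fun w => (sgpow (q - 1) (S n w) * a n)%:E).
  have ib : P.-integrable setT (fun w => (`|a n| * (1 + `|S n w|))%:E).
    under eq_fun do rewrite EFinM EFinD.
    apply: integrableZl => //; apply: integrableD => //; last exact: (integrable_abse (iS n)).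
    exact: finite_measure_integrable_cst.
  apply: integrable_le_EFin ib => // w.
  rewrite mulrC normrM ler_wpM2l// /sgpow normrM normr_sg norm_powR// normr_id.
  apply: (@le_trans _ _ (`|S n w| `^ (q - 1))).
    by case: (S n w != 0); rewrite ?mul1r// mul0r powR_ge0.
  have [S1|/ltW S1] := leP `|S n w| 1.
    apply: (@le_trans _ _ 1); last by rewrite lerDl.
    by apply: (@le_trans _ _ (1 `^ (q - 1))); [rewrite le_powRl// ltW|rewrite powR1].
  apply: (@le_trans _ _ `|S n w|); last by rewrite lerDr.
  by rewrite ler1_powR//; lra.
have i3 := past_integrable_prod mxi ind mpsi' mf ipsi (i_f n).
have e3 := past_integral_prod mxi ind mpsi' mf ipsi (i_f n).
rewrite f0 mule0 in e3.
apply: (@le_trans _ _ (\int[P]_w ((`|S n w| `^ q)%:E +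
   (q%:E * (sgpow (q - 1) (S n w) * a n * f (xi n w))%:E +
   (2 * q)%:E * (`|a n * f (xi n w)| `^ q)%:E)))%E).
  apply: ge0_le_integral => //.
  - apply/measurable_EFinP; exact: (measurableT_comp mq (mS' n.+1)).
  - apply: emeasurable_funD; first by apply/measurable_EFinP; exact: (measurableT_comp mq).
    apply: emeasurable_funD.
      by apply: measurable_funeM; case/integrableP: i3.
    by apply: measurable_funeM; case/integrableP: i2.
  - move=> w _; rewrite big_nat_recr//= lee_fin.
    have := powR_normD_le (S n w) (a n * f (xi n w)) q12.
    by move=> /le_trans; apply; rewrite le_eqVlt; apply/orP; left; apply/eqP; ring.
rewrite integralD//; last first.
  by apply: integrableD => //; apply: integrableZl.
rewrite integralD//; [|exact: integrableZl..].
rewrite !integralZl// e3 mule0 add0e big_nat_recr//= mulrDr EFinD leeD//.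
under eq_integral do rewrite normrM powRM// EFinM.
rewrite integralZl//; last first.
  apply/integrableP; split.
    by apply/measurable_EFinP; exact: (measurableT_comp mq).
  under eq_integral do rewrite gee0_abs ?lee_fin ?powR_ge0//.
  by apply: le_lt_trans (fK n) _; rewrite ltry.
rewrite [X in (_ <= X)%E](_ : _ = (2 * q)%:E * ((`|a n| `^ q)%:E * K%:E))%E.
  by rewrite !lee_wpmul2l ?lee_fin ?powR_ge0//; lra.
by rewrite -!EFinM; congr EFin; ring.
Qed.

Section second_moment.
Variable iota : R.
Hypothesis ixi : forall j, P.-integrable setT (fun w => (xi j w)%:E).
Hypothesis xi0 : forall j, (\int[P]_w (xi j w)%:E = 0)%E.
Hypothesis ixi2 : forall j, P.-integrable setT (fun w => (xi j w ^+ 2)%:E).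
Hypothesis xi2 : forall j, (\int[P]_w (xi j w ^+ 2)%:E = iota%:E)%E.

(** Orthogonality of martingale increments: the cross term 2 V U xi_n has mean 0. It serves linear
    forms, where U is constant, and quadratic forms, where U is a linear form in the past. *)
Lemma past_sqr_moment n (V U : T -> R) (v u : R) :
  measurable_fun setT (V : pastT xi n -> R) -> measurable_fun setT (U : pastT xi n -> R) ->
  P.-integrable setT (fun w => (V w ^+ 2)%:E) -> P.-integrable setT (fun w => (U w ^+ 2)%:E) ->
  (\int[P]_w (V w ^+ 2)%:E = v%:E)%E -> (\int[P]_w (U w ^+ 2)%:E = u%:E)%E ->
  P.-integrable setT (fun w => ((V w + U w * xi n w) ^+ 2)%:E) /\
  (\int[P]_w ((V w + U w * xi n w) ^+ 2)%:E = (v + iota * u)%:E)%E.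
Proof.
move=> mV mU iV iU eV eU.
have mVU : measurable_fun setT ((fun w => 2 * (V w * U w)) : pastT xi n -> R).
  by do 2!apply: measurable_funM => //.
have mU2 : measurable_fun setT ((fun w => U w ^+ 2) : pastT xi n -> R) by exact: measurable_funX.
have iVU : P.-integrable setT (fun w => (2 * (V w * U w))%:E).
  have : P.-integrable setT (fun w => (V w ^+ 2 + U w ^+ 2)%:E).
    by under eq_fun do rewrite EFinD; exact: integrableD.
  apply: integrable_le_EFin; first exact: (past_measurableT mVU).
  move=> w; rewrite !normrM (ger0_norm (ler0n _ _)) -[V w ^+ 2]real_normK ?num_real//.
  rewrite -[U w ^+ 2]real_normK ?num_real//; have := sqr_ge0 (`|V w| - `|U w|); nra.
have i1 := past_integrable_prod mxi ind mVU (@measurable_id _ _ setT) iVU (ixi n).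
have e1 := past_integral_prod mxi ind mVU (@measurable_id _ _ setT) iVU (ixi n).
rewrite /= xi0 mule0 in e1.
have msq : measurable_fun setT (fun x : R => x ^+ 2) by exact: measurable_funX.
have i2 := past_integrable_prod mxi ind mU2 msq iU (ixi2 n).
have e2 := past_integral_prod mxi ind mU2 msq iU (ixi2 n).
rewrite /= xi2 eU in e2.
have E w : ((V w + U w * xi n w) ^+ 2)%:E =
    ((V w ^+ 2)%:E + ((2 * (V w * U w) * xi n w)%:E + (U w ^+ 2 * xi n w ^+ 2)%:E))%E.
  by rewrite -!EFinD; congr EFin; ring.
have i12 : P.-integrable setT (fun w =>
    ((2 * (V w * U w) * xi n w)%:E + (U w ^+ 2 * xi n w ^+ 2)%:E)%E) by exact: integrableD.
split; first by under eq_fun do rewrite E; exact: integrableD.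
under eq_integral do rewrite E.
rewrite integralD// integralD// eV.
rewrite [X in (_ + (X + _))%E]e1 [X in (_ + (_ + X))%E]e2 add0e -EFinM -EFinD.
by congr EFin; ring.
Qed.

Lemma linear_form_sqr_moment (b : nat -> R) n :
  P.-integrable setT (fun w => ((\sum_(0 <= j < n) b j * xi j w) ^+ 2)%:E) /\
  (\int[P]_w ((\sum_(0 <= j < n) b j * xi j w) ^+ 2)%:E =
    (iota * \sum_(0 <= j < n) b j ^+ 2)%:E)%E.
Proof.
elim: n => [|n [IH1 IH2]].
  split; first by under eq_fun do rewrite big_geq// expr0n; exact: integrable0.
  by under eq_integral do rewrite big_geq// expr0n; rewrite integral0 big_geq// mulr0.
under eq_fun do rewrite big_nat_recr//=.
rewrite [in X in _ /\ X]big_nat_recr//= mulrDr.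
apply: past_sqr_moment => //.
- under eq_fun do rewrite big_mkord.
  apply: measurable_sum => i; apply: measurable_funM => //.
  exact: measurable_past_xi.
- exact: finite_measure_integrable_cst.
- exact: probability_integral_cst.
Qed.

(** The matrix is strictly triangular, so every increment is a linear form in the strict past times
    xi_v. One factor [iota] comes from xi_v, the other from the linear form. *)
Lemma quadratic_form_sqr_moment (a : nat -> nat -> R) n :
  P.-integrable setT (fun w =>
    ((\sum_(0 <= v < n) (\sum_(0 <= u < v) a v u * xi u w) * xi v w) ^+ 2)%:E) /\
  (\int[P]_w ((\sum_(0 <= v < n) (\sum_(0 <= u < v) a v u * xi u w) * xi v w) ^+ 2)%:E =
    (iota ^+ 2 * \sum_(0 <= v < n) \sum_(0 <= u < v) a v u ^+ 2)%:E)%E.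
Proof.
have mL m k : (m <= k)%N ->
    measurable_fun setT ((fun w => \sum_(0 <= u < m) a m u * xi u w) : pastT xi k -> R).
  move=> mk; under eq_fun do rewrite big_mkord.
  apply: measurable_sum => i; apply: measurable_funM => //.
  by apply: measurable_past_xi; apply: leq_trans mk.
elim: n => [|n [IH1 IH2]].
  split; first by under eq_fun do rewrite big_geq// expr0n; exact: integrable0.
  by under eq_integral do rewrite big_geq// expr0n; rewrite integral0 big_geq// mulr0.
under eq_fun do rewrite big_nat_recr//=.
rewrite [in X in _ /\ X]big_nat_recr//= mulrDr [iota ^+ 2 as X in (_ + X * _)]expr2 -mulrA.
have [i1 e1] := linear_form_sqr_moment (a n) n.
apply: past_sqr_moment => //; last exact: mL.
under eq_fun do rewrite big_mkord.
apply: measurable_sum => i; apply: measurable_funM => //.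
  by apply: mL; exact: ltnW.
by apply: measurable_past_xi.
Qed.

End second_moment.
End moments.

(** * Block sums *)

(** Off-diagonal terms are collected at their larger index v, so that z_v is multiplied by a form in
    earlier variables only. *)
Lemma bilinear_split (R : comNzRingType) (e f z : nat -> R) L :
  (\sum_(0 <= u < L) e u * z u) * (\sum_(0 <= v < L) f v * z v) =
  \sum_(0 <= u < L) e u * f u * z u ^+ 2 +
  \sum_(0 <= v < L) (\sum_(0 <= u < v) (e v * f u + e u * f v) * z u) * z v.
Proof.
elim: L => [|L IH]; first by rewrite !big_geq// mul0r addr0.
rewrite !big_nat_recr//= mulrDl !mulrDr IH.
have -> : \sum_(0 <= u < L) (e L * f u + e u * f L) * z u =
    e L * (\sum_(0 <= u < L) f u * z u) + f L * (\sum_(0 <= u < L) e u * z u).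
  by rewrite !mulr_sumr -big_split/=; apply: eq_bigr => i _; ring.
ring.
Qed.

Lemma sum_upper_sym_le (R : realDomainType) (F : nat -> nat -> R) L : (forall u v, 0 <= F u v) ->
  \sum_(0 <= v < L) \sum_(0 <= u < v) (F u v + F v u) <=
  \sum_(0 <= u < L) \sum_(0 <= v < L) F u v.
Proof.
move=> F0; elim: L => [|L IH]; first by rewrite !big_geq.
rewrite [in leLHS]big_nat_recr//= [in leRHS]big_nat_recr//=.
under [in leRHS]eq_bigr do rewrite big_nat_recr//=.
rewrite [X in _ <= _ + X]big_nat_recr//=.
rewrite !big_split/=; have := F0 L L; lra.
Qed.

(** The squared Frobenius norm of E^T F is the inner product of the Gram matrices E E^T and F F^T.
    With shifted coefficients as rows, the Gram entries are autocorrelations. *)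
Lemma sum_sqr_gram (R : comNzRingType) (E F : nat -> nat -> R) m L :
  \sum_(0 <= u < L) \sum_(0 <= v < L) (\sum_(0 <= k < m) E k u * F k v) ^+ 2 =
  \sum_(0 <= k < m) \sum_(0 <= l < m)
    (\sum_(0 <= u < L) E k u * E l u) * (\sum_(0 <= v < L) F k v * F l v).
Proof.
transitivity (\sum_(0 <= u < L) \sum_(0 <= v < L) \sum_(0 <= k < m) \sum_(0 <= l < m)
   (E k u * E l u) * (F k v * F l v)).
  apply: eq_bigr => u _; apply: eq_bigr => v _; rewrite expr2 mulr_suml.
  apply: eq_bigr => k _; rewrite mulr_sumr; apply: eq_bigr => l _; ring.
under eq_bigr do rewrite exchange_big/=.
rewrite exchange_big/=; apply: eq_bigr => k _.
under eq_bigr do rewrite exchange_big/=.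
rewrite exchange_big/=; apply: eq_bigr => l _.
rewrite mulr_suml; apply: eq_bigr => u _; rewrite mulr_sumr//.
Qed.

Lemma shift_coeff_sum (R : pzRingType) (c z : nat -> R) K L : (K < L)%N ->
  \sum_(0 <= u < L) shift_coeff c K u * z u = \sum_(0 <= u < K.+1) c (K - u)%N * z u.
Proof.
move=> KL; rewrite (@big_cat_nat _ _ _ K.+1)//= [X in _ + X]big1_seq ?addr0.
  by apply: eq_big_nat => i /andP[_]; rewrite ltnS /shift_coeff => ->.
move=> i /andP[_]; rewrite mem_index_iota => /andP[Ki _].
by rewrite /shift_coeff leqNgt Ki /= mul0r.
Qed.

Section block_coefficients.
Context (R : realType) (c : nat -> R) (h : nat).

Definition diag_coeff s m u : R :=
  \sum_(0 <= k < m) shift_coeff c (s + k) u * shift_coeff c (s + k + h) u.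

(** Here u belongs to the earlier factor X_K and v to X_(K+h). This is not symmetric in u and v, so
    both orders occur in the off-diagonal part. *)
Definition cross_coeff s m u v : R :=
  \sum_(0 <= k < m) shift_coeff c (s + k) u * shift_coeff c (s + k + h) v.

(** Used with f the identity for the centering and with f the absolute value for bounds; [f 0 = 0]
    discards the indices beyond K. *)
Lemma shift_coeff_corr_sum K L (f : R -> R) : (K < L)%N -> f 0 = 0 ->
  \sum_(0 <= u < L) f (shift_coeff c K u * shift_coeff c (K + h) u) =
  \sum_(0 <= i < K.+1) f (c i * c (i + h)%N).
Proof.
move=> KL f0; rewrite (@big_cat_nat _ _ _ K.+1)//= [X in _ + X]big1_seq ?addr0; last first.
  move=> i /andP[_]; rewrite mem_index_iota => /andP[Ki _].
  by rewrite /shift_coeff leqNgt Ki /= mul0r.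
rewrite [in RHS]big_nat_rev /=; apply: eq_big_nat => i /andP[_ iK].
by rewrite /shift_coeff !ifT; [congr (f (c _ * c _)); lia|lia..].
Qed.

(** The diagonal coefficients of the product at time K add up to the partial autocorrelation that
    centers it, so the centering is absorbed exactly into z_u^2 - iota. *)
Lemma block_split (iota : R) (z : nat -> R) s m L : (s + m + h <= L)%N ->
  \sum_(0 <= k < m) ((\sum_(0 <= u < (s + k).+1) c (s + k - u)%N * z u) *
     (\sum_(0 <= u < (s + k + h).+1) c (s + k + h - u)%N * z u) -
     iota * \sum_(0 <= i < (s + k).+1) c i * c (i + h)%N) =
  \sum_(0 <= u < L) diag_coeff s m u * (z u ^+ 2 - iota) +
  \sum_(0 <= v < L) (\sum_(0 <= u < v) (cross_coeff s m v u + cross_coeff s m u v) * z u) * z v.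
Proof.
move=> smL.
pose e k u := shift_coeff c (s + k) u; pose f k u := shift_coeff c (s + k + h) u.
transitivity (\sum_(0 <= k < m) (\sum_(0 <= u < L) e k u * f k u * (z u ^+ 2 - iota) +
   \sum_(0 <= v < L) (\sum_(0 <= u < v) (e k v * f k u + e k u * f k v) * z u) * z v)).
  apply: eq_big_nat => k /andP[_ km].
  rewrite -(@shift_coeff_sum _ c z (s + k) L); last by lia.
  rewrite -(@shift_coeff_sum _ c z (s + k + h) L); last by lia.
  rewrite bilinear_split -(@shift_coeff_corr_sum (s + k) L id)//; last by lia.
  rewrite addrAC; congr (_ + _); rewrite mulr_sumr -sumrB; apply: eq_bigr => u _.
  by rewrite /e /f; ring.
rewrite big_split/=; congr (_ + _).
  by rewrite exchange_big/=; apply: eq_bigr => u _; rewrite -mulr_suml.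
rewrite exchange_big/=; apply: eq_bigr => v _; rewrite -mulr_suml; congr (_ * _).
rewrite exchange_big/=; apply: eq_bigr => u _; rewrite -mulr_suml; congr (_ * _).
by rewrite big_split.
Qed.

(** With u fixed and the time K running, K - u runs through the indices of one partial
    autocorrelation sum. *)
Lemma diag_coeff_le (D : R) s m u : (forall N, \sum_(0 <= i < N) `|c i * c (i + h)%N| <= D) ->
  `|diag_coeff s m u| <= D.
Proof.
move=> hD; apply: (le_trans (ler_norm_sum _ _ _)).
apply: (@le_trans _ _ (\sum_(0 <= K < s + m) `|shift_coeff c K u * shift_coeff c (K + h) u|)).
  rewrite (@big_cat_nat _ _ _ s 0 (s + m))//= ?leq_addr//.
  rewrite [X in _ <= _ + X](_ : _ =
    \sum_(0 <= k < m) `|shift_coeff c (s + k) u * shift_coeff c (s + k + h) u|); last first.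
    by rewrite -{1}[s]add0n big_addn addKn; apply: eq_bigr => i _; rewrite [(i + s)%N]addnC.
  by rewrite lerDr; apply: sumr_ge0.
have [us|us] := leqP (s + m) u.
  rewrite big1_seq; first by have := hD 0%N; rewrite big_geq.
  move=> K /andP[_]; rewrite mem_index_iota => /andP[_ Ks].
  by rewrite /shift_coeff leqNgt (leq_trans Ks us) /= mul0r normr0.
rewrite (@big_cat_nat _ _ _ u)//= ?(ltnW us)// big1_seq ?add0r; last first.
  move=> K /andP[_]; rewrite mem_index_iota => /andP[_ Ku].
  by rewrite /shift_coeff leqNgt Ku /= mul0r normr0.
apply: le_trans (hD (s + m - u)%N); rewrite -{1}[u]add0n big_addn le_eqVlt; apply/orP; left; apply/eqP.
apply: eq_big_nat => i _; rewrite /shift_coeff !ifT; [|lia..].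
by congr (`| c _ * c _|); lia.
Qed.

Lemma sum_diag_coeff_le (D : R) s m L : (forall N, \sum_(0 <= i < N) `|c i * c (i + h)%N| <= D) ->
  (s + m + h <= L)%N -> \sum_(0 <= u < L) `|diag_coeff s m u| <= D *+ m.
Proof.
move=> hD smL.
apply: (@le_trans _ _ (\sum_(0 <= u < L) \sum_(0 <= k < m)
    `|shift_coeff c (s + k) u * shift_coeff c (s + k + h) u|)).
  by apply: ler_sum => u _; exact: ler_norm_sum.
rewrite exchange_big/= -[X in _ *+ X]subn0 -sumr_const_nat !big_nat.
apply: ler_sum => k /andP[_ km].
rewrite (@shift_coeff_corr_sum (s + k) L (fun x => `|x|)) ?normr0//; lia.
Qed.

(** Interpolation between the sup bound D and the l^1 bound D m: |a|^q <= D^(q-1) |a|. *)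
Lemma sum_diag_coeff_powR_le (q D : R) s m L : 1 < q ->
  (forall N, \sum_(0 <= i < N) `|c i * c (i + h)%N| <= D) ->
  (s + m + h <= L)%N -> \sum_(0 <= u < L) `|diag_coeff s m u| `^ q <= D `^ q * m%:R.
Proof.
move=> q1 hD smL.
have D0 : 0 <= D by have := hD 0%N; rewrite big_geq.
apply: (@le_trans _ _ (\sum_(0 <= u < L) D `^ (q - 1) * `|diag_coeff s m u|)).
  apply: ler_sum => u _; rewrite -(@mulr_powRB1 _ `|_|)//; last by lra.
  rewrite mulrC ler_wpM2r// le_powRl//; first by lra.
  exact: diag_coeff_le.
rewrite -mulr_sumr -[in leRHS](@mulr_powRB1 _ D q)//; last by lra.
rewrite [D * _]mulrC -mulrA ler_wpM2l ?powR_ge0// mulr_natr.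
exact: sum_diag_coeff_le.
Qed.

(** By the Gram identity the sum of squares is a sum over pairs of times k, l in the block. Shifting
    both times by s or h keeps their distance, so both Gram factors obey the same bound. *)
Lemma sum_cross_coeff_le (C kappa : R) s m L : 0 <= C ->
  (forall N t, \sum_(0 <= i < N) `|c i * c (i + t)%N| <= C * t.+1%:R `^ (- kappa)) ->
  (s + m + h <= L)%N ->
  \sum_(0 <= v < L) \sum_(0 <= u < v) (cross_coeff s m v u + cross_coeff s m u v) ^+ 2 <=
  2 * C ^+ 2 * \sum_(0 <= k < m) \sum_(0 <= l < m) ((dist k l).+1%:R `^ (- kappa)) ^+ 2.
Proof.
move=> C0 hC smL.
apply: (@le_trans _ _ (2 * \sum_(0 <= v < L) \sum_(0 <= u < v)
   (cross_coeff s m u v ^+ 2 + cross_coeff s m v u ^+ 2))).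
  rewrite mulr_sumr; apply: ler_sum => v _; rewrite mulr_sumr; apply: ler_sum => u _.
  by have := sqr_ge0 (cross_coeff s m v u - cross_coeff s m u v); nra.
rewrite -mulrA ler_wpM2l//.
apply: (le_trans (@sum_upper_sym_le _ (fun u v => cross_coeff s m u v ^+ 2) L _)).
  by move=> u v; exact: sqr_ge0.
rewrite /cross_coeff (sum_sqr_gram (fun k => shift_coeff c (s + k)) (fun k => shift_coeff c (s + k + h))).
rewrite mulr_sumr !big_nat; apply: ler_sum => k /andP[_ km].
rewrite mulr_sumr !big_nat; apply: ler_sum => l /andP[_ lm].
apply: (le_trans (ler_norm _)); rewrite normrM.
apply: (@le_trans _ _ ((C * (dist k l).+1%:R `^ (- kappa)) * (C * (dist k l).+1%:R `^ (- kappa)))).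
  apply: ler_pM => //.
    have := @shift_coeff_corr R c C kappa (s + k) (s + l) L hC.
    rewrite (_ : dist (s + k) (s + l) = dist k l); last by rewrite /dist; lia.
    by apply; lia.
  have := @shift_coeff_corr R c C kappa (s + k + h) (s + l + h) L hC.
  rewrite (_ : dist (s + k + h) (s + l + h) = dist k l); last by rewrite /dist; lia.
  by apply; lia.
by rewrite le_eqVlt; apply/orP; left; apply/eqP; ring.
Qed.

End block_coefficients.

(** * Moments from tails, and the q-th moment of a block *)

Lemma nneseries_le_cst (R : realType) (u : (\bar R)^nat) (K : \bar R) :
  (forall n, 0 <= u n)%E -> (forall n, \sum_(0 <= i < n) u i <= K)%E -> (\sum_(0 <= i <oo) u i <= K)%E.
Proof.
move=> u0 uK; apply: lime_le; first by apply: is_cvg_nneseries => n _ _; exact: u0.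
exact: nearW.
Qed.

(** Dyadic layers: Y^q is at most 1 plus the sum of 2^((r+1)q) over the r with Y > 2^r. The tail
    bound makes the expectations geometric with ratio 2^(q - alpha) < 1. *)
Lemma tail_moment d (T : measurableType d) (R : realType) (P : probability T R)
  (Y : T -> R) (alpha q M : R) : measurable_fun setT Y -> (forall w, 0 <= Y w) -> 0 < q -> q < alpha ->
  (forall t : R, 0 <= t -> ((t `^ alpha)%:E * P [set w | (t < Y w)%R] <= M%:E)%E) ->
  exists2 K : R, 0 <= K & (\int[P]_w (Y w `^ q)%:E <= K%:E)%E.
Proof.
move=> mY Y0 q0 qa hM.
have M0 : 0 <= M.
  by rewrite -lee_fin; apply: le_trans (hM 0 (lexx _)); rewrite mule_ge0// lee_fin powR_ge0.
pose A r := [set w | (2 ^+ r < Y w)%R].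
have mA r : measurable (A r).
  rewrite -[A r]setTI; exact: measurable_fun_ltr.
pose x := (2 : R) `^ (q - alpha).
have x0 : 0 <= x by exact: powR_ge0.
have x1 : x < 1.
  rewrite /x -opprB powRN invf_lt1 ?powR_gt0//.
  by rewrite powR_gt1 ?subr_gt0 ?ltr1n.
pose K := 2 `^ q * M / (1 - x).
have K0 : 0 <= K by rewrite /K divr_ge0 ?mulr_ge0 ?powR_ge0// subr_ge0 ltW.
exists (1 + K); first by rewrite addr_ge0.
pose f r w := (((2 ^+ r.+1) `^ q)%:E * (\1_(A r) w)%:E)%E.
have f0 r w : (0 <= f r w)%E by rewrite mule_ge0// lee_fin ?powR_ge0.
have mf r : measurable_fun setT (f r).
  by apply: measurable_funeM; apply/measurable_EFinP.
have fE r : (\int[P]_w f r w <= (2 `^ q * M * x ^+ r)%:E)%E.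
  rewrite /f ge0_integralZl//; last by apply/measurable_EFinP.
  rewrite integral_indic// setIT.
  have p0 : 0 < ((2 : R) ^+ r) `^ alpha by rewrite powR_gt0 ?exprn_gt0.
  have := hM (2 ^+ r) (exprn_ge0 _ (ler0n _ _)); rewrite -/(A r).
  rewrite muleC -lee_pdivlMr// => hr.
  apply: (@le_trans _ _ (((2 ^+ r.+1) `^ q)%:E * (M%:E * ((2 ^+ r) `^ alpha)^-1%:E))%E).
    by rewrite lee_wpmul2l// lee_fin powR_ge0.
  rewrite -!EFinM lee_fin le_eqVlt; apply/orP; left; apply/eqP.
  rewrite -powRN exprS powRM ?exprn_ge0// -!mulrA; congr (_ * _).
  rewrite mulrCA; congr (_ * _).
  rewrite -powRD; last by rewrite expf_eq0 pnatr_eq0 andbF implybT.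
  by rewrite -(powR_mulrn r (ler0n _ 2)) -powRrM mulrC powRrM -/x powR_mulrn.
apply: (@le_trans _ _ (\int[P]_w (1 + \sum_(0 <= r <oo) f r w))%E).
  apply: ge0_le_integral => //.
  - by move=> w _; rewrite lee_fin powR_ge0.
  - by apply/measurable_EFinP; apply: (measurableT_comp (measurable_powR _)).
  - apply: emeasurable_funD => //; exact: ge0_emeasurable_sum.
  - move=> w _; have s0 : (0 <= \sum_(0 <= r <oo) f r w)%E by exact: nneseries_ge0.
    have [Y1|Y1] := leP (Y w) 1.
      rewrite -[leLHS]adde0 leeD// lee_fin.
      by apply: (@le_trans _ _ (1 `^ q)); [rewrite le_powRl// ltW|rewrite powR1].
    have [n Yn] : exists n, Y w <= 2 ^+ n.
      exists (Num.bound (Y w)); rewrite ltW// (lt_trans (archi_boundP _))//.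
      by rewrite -natrX ltr_nat ltn_expl.
    have ex : exists n, Y w <= 2 ^+ n by exists n.
    (* Minimality places Y between 2^r and 2^(r+1), and the r-th layer alone then dominates Y^q. *)
    have := ex_minnP ex => -[[|r] Yr rmin]; first by rewrite expr0 leNgt Y1 in Yr.
    have rY : A r w.
      by rewrite /A /= ltNge; apply/negP => /rmin; rewrite ltnn.
    apply: (@le_trans _ _ (\sum_(0 <= i < r.+1) f i w)%E); last first.
      apply: (@le_trans _ _ (\sum_(0 <= r <oo) f r w)%E); first exact: nneseries_lim_ge.
      by rewrite leeDr// lee_fin.
    rewrite big_nat_recr//= (@le_trans _ _ (f r w))//; last first.
      by rewrite leeDr// sume_ge0.
    by rewrite /f indicE mem_set// mule1 lee_fin le_powRl// ltW.
rewrite ge0_integralD//; last 2 first.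
- by move=> w _; exact: nneseries_ge0.
- exact: ge0_emeasurable_sum.
rewrite probability_integral_cst EFinD leeD//.
rewrite integral_nneseries//.
apply: nneseries_le_cst => [n|n]; first exact: integral_ge0.
apply: (@le_trans _ _ (\sum_(0 <= i < n) (2 `^ q * M * x ^+ i)%:E)%E).
  by apply: lee_sum => i _; exact: fE.
rewrite sumEFin lee_fin /K -mulr_sumr ler_wpM2l ?mulr_ge0 ?powR_ge0//.
exact: geometric_sum_le.
Qed.

Lemma ident_integral d (T : measurableType d) (R : realType) (P : probability T R)
  (X Y : T -> R) (g : R -> \bar R) :
  measurable_fun setT X -> measurable_fun setT Y -> measurable_fun setT g ->
  (forall B, measurable B -> P (X @^-1` B) = P (Y @^-1` B)) ->
  (forall x, 0 <= g x)%E -> (\int[P]_w g (X w) = \int[P]_w g (Y w))%E.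
Proof.
move=> mX mY mg XY g0.
have := @ge0_integral_pushforward _ _ _ _ R X mX P setT g measurableT mg.
rewrite preimage_setT => <-//.
have := @ge0_integral_pushforward _ _ _ _ R Y mY P setT g measurableT mg.
rewrite preimage_setT => <-//.
by apply: eq_measure_integral => B mB _; exact: XY.
Qed.

(** [C'] is chosen before the noise, the position and the length, so that one constant serves all
    cut-offs N. *)
Lemma block_moment d (T : measurableType d) (R : realType) (P : probability T R)
  (c : nat -> R) (h : nat) (iota q K C kappa beta : R) :
  1 < q <= 2 -> 0 <= beta -> 1 < 2 * kappa + beta -> 0 <= C -> 0 <= K ->
  (forall N t, \sum_(0 <= i < N) `|c i * c (i + t)%N| <= C * t.+1%:R `^ (- kappa)) ->
  exists2 C' : R, 0 <= C' & forall xi : nat -> T -> R,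
    (forall j, measurable_fun setT (xi j)) -> mutually_independent P xi ->
    (forall j, P.-integrable setT (fun w => (xi j w)%:E)) ->
    (forall j, \int[P]_w (xi j w)%:E = 0)%E ->
    (forall j, P.-integrable setT (fun w => (xi j w ^+ 2)%:E)) ->
    (forall j, \int[P]_w (xi j w ^+ 2)%:E = iota%:E)%E ->
    (forall j, \int[P]_w (`|xi j w ^+ 2 - iota| `^ q)%:E <= K%:E)%E ->
    forall s m, (\int[P]_w (`|\sum_(0 <= k < m)
       ((\sum_(0 <= u < (s + k).+1) c (s + k - u)%N * xi u w) *
        (\sum_(0 <= u < (s + k + h).+1) c (s + k + h - u)%N * xi u w) -
        iota * \sum_(0 <= i < (s + k).+1) c i * c (i + h)%N)| `^ q)%:E <=
      (C' * m%:R `^ (Num.max 1 ((1 + beta) * q / 2)))%:E)%E.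
Proof.
move=> q12; have /andP[q1 q2] := q12; move=> b0 kb C0 K0 hC.
have [C2 C20 hC2] := double_sum_dist_le b0 kb.
pose D := C * h.+1%:R `^ (- kappa).
have hD N : \sum_(0 <= i < N) `|c i * c (i + h)%N| <= D by exact: hC.
have q0 : 0 < q by lra.
exists (4 * (2 * q * K * D `^ q + 1 + iota ^+ 2 * (2 * C ^+ 2 * C2))).
  apply: mulr_ge0 => //; apply: addr_ge0; last exact: (mulr_ge0 (sqr_ge0 _) (mulr_ge0 (mulr_ge0 (ler0n _ 2) (sqr_ge0 _)) C20)).
  by rewrite addr_ge0// !mulr_ge0 ?powR_ge0// ltW.
move=> xi mxi ind ixi xi0 ixi2 xi2 xiK s m.
have [->|m0] := posnP m.
  under eq_integral do rewrite big_geq// normr0 powR0 ?gt_eqF//.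
  rewrite integral0 powR0 ?mulr0//.
  by rewrite gt_eqF// lt_max ltr01.
pose L := (s + m + h)%N.
pose Dg w := \sum_(0 <= u < L) diag_coeff c h s m u * (xi u w ^+ 2 - iota).
pose Of w := \sum_(0 <= v < L) (\sum_(0 <= u < v)
  (cross_coeff c h s m v u + cross_coeff c h s m u v) * xi u w) * xi v w.
under eq_integral do rewrite (block_split c iota (fun u => xi u _) (leqnn L)) -/(Dg _) -/(Of _).
have mDg : measurable_fun setT Dg.
  rewrite /Dg; under eq_fun do rewrite big_mkord.
  apply: measurable_sum => i; apply: measurable_funM => //.
  by apply: measurable_funB => //; exact: measurable_funX.
have mOf : measurable_fun setT Of.
  rewrite /Of; under eq_fun do rewrite big_mkord.
  apply: measurable_sum => i; apply: measurable_funM => //.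
  under eq_fun do rewrite big_mkord.
  by apply: measurable_sum => j; exact: measurable_funM.
have mq : measurable_fun setT (fun x : R => `|x| `^ q).
  by apply: (measurableT_comp (measurable_powR _)); exact: normr_measurable.
(* The order of the standard deviation of [Of]; with it both terms of [powR_norm_le_sqr] become
   m^((1+beta)q/2). *)
pose S := (m%:R : R) `^ ((1 + beta) / 2).
have S0 : 0 < S by rewrite powR_gt0// ltr0n.
have iDg : (\int[P]_w (`|Dg w| `^ q)%:E <= (2 * q * K * (D `^ q * m%:R))%:E)%E.
  have mf : measurable_fun setT (fun x : R => x ^+ 2 - iota).
    by apply: measurable_funB => //; exact: measurable_funX.
  have if_ j : P.-integrable setT (fun w => (xi j w ^+ 2 - iota)%:E).
    under eq_fun do rewrite EFinB; apply: integrableB => //.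
    exact: finite_measure_integrable_cst.
  have f0 j : (\int[P]_w (xi j w ^+ 2 - iota)%:E = 0)%E.
    under eq_integral do rewrite EFinB; rewrite integralB//; last exact: finite_measure_integrable_cst.
    by rewrite xi2 probability_integral_cst subee.
  apply: (le_trans (sum_moment_le mxi ind (diag_coeff c h s m) L q12 mf if_ f0 xiK)).
  rewrite lee_fin ler_wpM2l ?mulr_ge0 ?(ltW q0)//.
  exact: sum_diag_coeff_powR_le.
have iOf : (\int[P]_w (Of w ^+ 2)%:E <= (iota ^+ 2 * (2 * C ^+ 2 * C2 * m%:R `^ (1 + beta)))%:E)%E.
  have [_ ->] := quadratic_form_sqr_moment mxi ind ixi xi0 ixi2 xi2
    (fun v u => cross_coeff c h s m v u + cross_coeff c h s m u v) L.
  rewrite lee_fin ler_wpM2l ?sqr_ge0//.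
  apply: (le_trans (sum_cross_coeff_le C0 hC (leqnn L))).
  by rewrite -[X in _ <= X]mulrA ler_wpM2l ?mulr_ge0 ?sqr_ge0.
apply: (@le_trans _ _ (\int[P]_w (4%:E * ((`|Dg w| `^ q)%:E +
    ((S `^ q)%:E + (S `^ (q - 2))%:E * (Of w ^+ 2)%:E))))%E).
  apply: ge0_le_integral => //.
  - by apply/measurable_EFinP; apply: (measurableT_comp mq); exact: measurable_funD.
  - apply: measurable_funeM; apply: emeasurable_funD.
      by apply/measurable_EFinP; exact: (measurableT_comp mq).
    apply: emeasurable_funD => //; apply: measurable_funeM.
    by apply/measurable_EFinP; exact: measurable_funX.
  - move=> w _; rewrite -[leRHS]/((4 * (`|Dg w| `^ q + (S `^ q + S `^ (q - 2) * Of w ^+ 2)))%:E) lee_fin.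
    have q02 : 0 < q <= 2 by rewrite q0.
    apply: (le_trans (powR_normD_le2 (Dg w) (Of w) q02)).
    by rewrite ler_wpM2l// lerD2l; exact: powR_norm_le_sqr.
have m1 : measurable_fun setT (fun w => (`|Dg w| `^ q)%:E).
  by apply/measurable_EFinP; exact: (measurableT_comp mq).
have m2 : measurable_fun setT (fun w => (Of w ^+ 2)%:E).
  by apply/measurable_EFinP; exact: measurable_funX.
have m3 : measurable_fun setT (fun w => ((S `^ (q - 2))%:E * (Of w ^+ 2)%:E)%E) by exact: measurable_funeM.
have p1 w : (0 <= (`|Dg w| `^ q)%:E)%E by rewrite lee_fin powR_ge0.
have p2 w : (0 <= (Of w ^+ 2)%:E)%E by rewrite lee_fin sqr_ge0.
have p3 w : (0 <= (S `^ (q - 2))%:E * (Of w ^+ 2)%:E)%E by rewrite mule_ge0// lee_fin powR_ge0.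
have p4 w : (0 <= (S `^ q)%:E + (S `^ (q - 2))%:E * (Of w ^+ 2)%:E)%E.
  by rewrite adde_ge0// lee_fin powR_ge0.
rewrite ge0_integralZl//; last 2 first.
- by apply: emeasurable_funD => //; apply: emeasurable_funD.
- by move=> w _; exact: adde_ge0.
rewrite ge0_integralD//; last by apply: emeasurable_funD.
rewrite ge0_integralD//; last by move=> w _; rewrite lee_fin powR_ge0.
rewrite ge0_integralZl//; last by rewrite lee_fin powR_ge0.
rewrite probability_integral_cst.
set th := Num.max 1 _.
have h1 : (m%:R : R) <= m%:R `^ th.
  rewrite -[X in X <= _]powRr1 ?ler0n// ler_powR ?ler1n//.
  by rewrite /th le_max lexx.
have h2 : (m%:R : R) `^ ((1 + beta) * q / 2) <= m%:R `^ th.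
  by rewrite ler_powR ?ler1n// /th le_max lexx orbT.
have h3 : S `^ q = (m%:R : R) `^ ((1 + beta) * q / 2).
  by rewrite /S -powRrM; congr (_ `^ _); field.
have h4 : S `^ (q - 2) * m%:R `^ (1 + beta) = (m%:R : R) `^ ((1 + beta) * q / 2).
  rewrite /S -powRrM -powRD; last by rewrite pnatr_eq0 -lt0n m0 implybT.
  by congr (_ `^ _); field.
apply: (@le_trans _ _ (4%:E * ((2 * q * K * (D `^ q * m%:R))%:E + ((S `^ q)%:E +
    (S `^ (q - 2))%:E * (iota ^+ 2 * (2 * C ^+ 2 * C2 * m%:R `^ (1 + beta)))%:E)))%E).
  rewrite lee_wpmul2l// leeD// leeD// lee_wpmul2l// lee_fin powR_ge0//.
rewrite -[leLHS]/((4 * (2 * q * K * (D `^ q * m%:R) + (S `^ q +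
  S `^ (q - 2) * (iota ^+ 2 * (2 * C ^+ 2 * C2 * m%:R `^ (1 + beta))))))%:E).
rewrite lee_fin -[leRHS]mulrA ler_wpM2l//.
have -> : S `^ (q - 2) * (iota ^+ 2 * (2 * C ^+ 2 * C2 * m%:R `^ (1 + beta))) =
   iota ^+ 2 * (2 * C ^+ 2 * C2) * (S `^ (q - 2) * m%:R `^ (1 + beta)) by ring.
have c1 : 0 <= 2 * q * K * D `^ q by rewrite !mulr_ge0 ?powR_ge0// ltW.
have c2 : 0 <= iota ^+ 2 * (2 * C ^+ 2 * C2).
  exact: (mulr_ge0 (sqr_ge0 _) (mulr_ge0 (mulr_ge0 (ler0n _ 2) (sqr_ge0 _)) C20)).
have := ler_wpM2l c1 h1; have := ler_wpM2l c2 h2.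
move=> g1 g2; rewrite h4 h3 [leRHS](_ : _ = 2 * q * K * D `^ q * m%:R `^ th +
  (m%:R `^ th + iota ^+ 2 * (2 * C ^+ 2 * C2) * m%:R `^ th)); last by ring.
by rewrite [2 * q * K * (_ * _)]mulrA lerD ?lerD.
Qed.

(** * Almost sure bounds *)

Lemma limn_einf_le_cst (R : realType) (u : (\bar R)^nat) (K : \bar R) :
  (forall n, u n <= K)%E -> (limn_einf u <= K)%E.
Proof.
move=> uK; rewrite limn_einf_lim; apply: lime_le; first exact: is_cvg_einfs.
apply: nearW => n; apply: le_trans (uK n); apply: ereal_inf_lbound => /=.
by exists n => //=.
Qed.

Lemma limn_einf_ge0 (R : realType) (u : (\bar R)^nat) :
  (forall n, 0 <= u n)%E -> (0 <= limn_einf u)%E.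
Proof.
move=> u0; rewrite limn_einf_lim; apply: lime_ge; first exact: is_cvg_einfs.
by apply: nearW => n; apply: le_ereal_inf_tmp => /= _ [k _ <-].
Qed.

Lemma nneseries_term_le (R : realType) (u : (\bar R)^nat) n :
  (forall n, 0 <= u n)%E -> (u n <= \sum_(0 <= i <oo) u i)%E.
Proof.
move=> u0; apply: (@le_trans _ _ (\sum_(0 <= i < n.+1) u i)%E).
  by rewrite big_nat_recr//= leeDr// sume_ge0.
by apply: nneseries_lim_ge => k _ _; exact: u0.
Qed.

(* The limits V need not be measurable, so the moment bound is passed to the lower limits
   of the approximations W, to which Fatou's lemma applies. *)
Lemma ae_dyadic_bound d (T : measurableType d) (R : realType) (P : probability T R)
  (W : nat -> nat -> nat -> T -> R) (V : nat -> nat -> T -> R) (C th t : R) :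
  0 <= C -> 1 <= th -> th < t ->
  (forall N l b, measurable_fun setT (W N l b)) -> (forall N l b w, 0 <= W N l b w) ->
  (forall N l b, \int[P]_w (W N l b w)%:E <= (C * (2 ^ l)%:R `^ th)%:E)%E ->
  {ae P, forall w, forall l b, W N l b w @[N --> \oo] --> V l b w} ->
  {ae P, forall w, exists2 G : R, 0 <= G &
    forall l b, V l b w <= G * ((b.+1 * 2 ^ l)%:R : R) `^ t}.
Proof.
move=> C0 th1 tht mW W0 iW WV.
pose U l b w := limn_einf (fun N => (W N l b w)%:E).
have U0 l b w : (0 <= U l b w)%E by apply: limn_einf_ge0 => N; rewrite lee_fin.
have mU l b : measurable_fun setT (U l b).
  apply: measurableT_comp; first exact: oppe_measurable.
  apply: measurable_fun_limn_esup => N; apply: measurableT_comp; first exact: oppe_measurable.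
  exact/measurable_EFinP.
have iU l b : (\int[P]_w U l b w <= (C * (2 ^ l)%:R `^ th)%:E)%E.
  have mWE N : measurable_fun setT (fun w => (W N l b w)%:E) by exact/measurable_EFinP.
  apply: (le_trans (fatou P measurableT mWE _)); first by move=> N w _; rewrite lee_fin.
  exact: limn_einf_le_cst.
have [A A0 hA] := sum_powRN_le (le_lt_trans th1 tht).
pose x := (2 : R) `^ (th - t).
have x0 : 0 <= x by exact: powR_ge0.
have x1 : x < 1.
  by rewrite /x -opprB powRN invf_lt1 ?powR_gt0// powR_gt1 ?subr_gt0 ?ltr1n.
(* With this weight the expectation is C x^l (b+1)^(-t): summable in b because t > 1, in l because t
   > th. *)
pose F l b w := (((b.+1 * 2 ^ l)%:R `^ (- t))%:E * U l b w)%E.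
have F0 l b w : (0 <= F l b w)%E by rewrite mule_ge0// lee_fin powR_ge0.
have mF l b : measurable_fun setT (F l b) by exact: measurable_funeM.
have iF l b : (\int[P]_w F l b w <= (C * x ^+ l * b.+1%:R `^ (- t))%:E)%E.
  rewrite ge0_integralZl// ?lee_fin ?powR_ge0//.
  apply: (@le_trans _ _ (((b.+1 * 2 ^ l)%:R `^ (- t))%:E * (C * (2 ^ l)%:R `^ th)%:E)%E).
    by rewrite lee_wpmul2l// lee_fin powR_ge0.
  rewrite -EFinM lee_fin natrM powRM ?ler0n// le_eqVlt; apply/orP; left; apply/eqP.
  rewrite -[x ^+ l]powR_mulrn// /x -powRrM [(th - t) * _]mulrC powRrM powR_mulrn ?ler0n// -natrX.
  rewrite [th - t]addrC powRD; last by rewrite pnatr_eq0 expn_eq0 implybT.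
  ring.
pose H l w := (\sum_(0 <= b <oo) F l b w)%E.
have H0 l w : (0 <= H l w)%E by exact: nneseries_ge0.
have mH l : measurable_fun setT (H l) by exact: ge0_emeasurable_sum.
have iH l : (\int[P]_w H l w <= (C * A * x ^+ l)%:E)%E.
  rewrite integral_nneseries//; apply: nneseries_le_cst => [n|n]; first exact: integral_ge0.
  apply: (@le_trans _ _ (\sum_(0 <= b < n) (C * x ^+ l * b.+1%:R `^ (- t))%:E)%E).
    by apply: lee_sum => b _; exact: iF.
  rewrite sumEFin lee_fin -mulr_sumr [leRHS]mulrAC.
  by rewrite ler_wpM2l// mulr_ge0// exprn_ge0.
pose G w := (\sum_(0 <= l <oo) H l w)%E.
have G0 w : (0 <= G w)%E by exact: nneseries_ge0.
have mG : measurable_fun setT G by exact: ge0_emeasurable_sum.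
have iG : P.-integrable setT G.
  apply/integrableP; split => //.
  under eq_integral do rewrite gee0_abs//.
  rewrite integral_nneseries//; apply: (@le_lt_trans _ _ (C * A * (1 - x)^-1)%:E); last exact: ltry.
  apply: nneseries_le_cst => [n|n]; first exact: integral_ge0.
  apply: (@le_trans _ _ (\sum_(0 <= l < n) (C * A * x ^+ l)%:E)%E).
    by apply: lee_sum => l _; exact: iH.
  rewrite sumEFin lee_fin -mulr_sumr ler_wpM2l// ?mulr_ge0//; first exact: ltW.
  exact: geometric_sum_le.
have := integrable_ae measurableT iG.
apply: filterS2 WV => w WVw /(_ Logic.I) Gw.
exists (fine (G w)); first exact: fine_ge0.
move=> l b; have p0 : 0 < ((b.+1 * 2 ^ l)%:R : R) `^ t.
  by rewrite powR_gt0// ltr0n muln_gt0 expn_gt0.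
have : (F l b w <= G w)%E.
  by apply: (le_trans (nneseries_term_le b (F0 l ^~ w))); exact: (nneseries_term_le l (H0 ^~ w)).
have UV : U l b w = (V l b w)%:E.
  have : (W N l b w)%:E @[N --> \oo] --> (V l b w)%:E.
    by apply: cvg_EFin; [exact: nearW|exact: WVw].
  by move/cvg_limn_einf_sup => [].
rewrite /F UV -(fineK Gw) -EFinM lee_fin powRN mulrC ler_pdivrMr//.
Qed.

(** |y|^q is the square of [sgpow (q / 2) y], and q/2 <= 1 makes that function Hoelder
    continuous. *)
Lemma cvg_powR_norm (R : realType) (q a : R) (u : nat -> R) : 0 < q <= 2 ->
  u @ \oo --> a -> `|u n| `^ q @[n --> \oo] --> `|a| `^ q.
Proof.
move=> /andP[q0 q2] ua; pose r := q / 2.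
have r0 : 0 < r by rewrite /r; lra.
have E y : `|y| `^ q = sgpow r y * sgpow r y.
  have [->|y0] := eqVneq y 0.
    by rewrite normr0 powR0 ?gt_eqF// /sgpow normr0 powR0 ?gt_eqF// mulr0 mul0r.
  rewrite /sgpow mulrACA -expr2 sqr_sg y0 mul1r -powRD; last by rewrite normr_eq0 y0 implybT.
  by congr (_ `^ _); rewrite /r; lra.
under eq_fun do rewrite E; rewrite E.
suff : sgpow r (u n) @[n --> \oo] --> sgpow r a by move=> h; exact: cvgM.
apply/cvgrPdist_lt => e e0; move/cvgrPdist_lt : ua.
have d0 : 0 < (e / 2) `^ r^-1 by rewrite powR_gt0 ?divr_gt0.
move=> /(_ _ d0); apply: filterS => n un.
have rr : 0 < r <= 1 by rewrite r0 /r; lra.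
apply: (le_lt_trans (sgpow_hoelder a (u n) rr)).
have /(_ `|a - u n| ((e / 2) `^ r^-1)) := @gt0_ltr_powR R r r0.
rewrite !nnegrE normr_ge0 powR_ge0 => /(_ isT isT un).
rewrite -powRrM mulVf ?gt_eqF// powRr1 ?divr_ge0 ?(ltW e0)//; lra.
Qed.

Lemma cvg_powRN (R : realType) (e : R) : 0 < e -> (n%:R : R) `^ (- e) @[n --> \oo] --> (0 : R).
Proof.
move=> e0; apply/cvgrPdist_lt => z z0.
have := nbhs_infty_gtr ((z^-1) `^ e^-1); apply: filterS => n hn.
rewrite sub0r normrN ger0_norm ?powR_ge0// powRN invf_plt ?posrE//; last first.
  by rewrite powR_gt0// (le_lt_trans _ hn)// powR_ge0.
have /(_ ((z^-1) `^ e^-1) n%:R) := @gt0_ltr_powR R e e0.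
rewrite !nnegrE ler0n powR_ge0 => /(_ isT isT hn).
by rewrite -powRrM mulVf ?gt_eqF// powRr1// invr_ge0 ltW.
Qed.

(** * Passage to one-sided noise, exponents and limits *)

Lemma ident_integrable d (T : measurableType d) (R : realType) (P : probability T R)
  (X Y : T -> R) (g : R -> \bar R) :
  measurable_fun setT X -> measurable_fun setT Y -> measurable_fun setT g ->
  (forall B, measurable B -> P (X @^-1` B) = P (Y @^-1` B)) ->
  P.-integrable setT (fun w => g (Y w)) ->
  P.-integrable setT (fun w => g (X w)) /\ (\int[P]_w g (X w) = \int[P]_w g (Y w))%E.
Proof.
move=> mX mY mg XY iY.
have iX : P.-integrable setT (fun w => g (X w)).
  move/integrableP : iY => [_ iY]; apply/integrableP; split; first exact: measurableT_comp.
  rewrite (ident_integral (g := fun x => `|g x|%E) mX mY _ XY)//.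
  exact: measurableT_comp.
split=> //.
have := integral_pushforward mX mg _ measurableT; rewrite preimage_setT => <-//.
have := integral_pushforward mY mg _ measurableT; rewrite preimage_setT => <-//.
by apply: eq_measure_integral => B mB _; exact: XY.
Qed.

Lemma mutually_independent_reindex d (T : measurableType d) (R : realType)
  (P : probability T R) (I I' : eqType) (X : I -> T -> R) (f : I' -> I) (g : I -> I') :
  cancel f g -> mutually_independent P X -> mutually_independent P (fun i => X (f i)).
Proof.
move=> fg ind J B uJ mB.
have uJ' : uniq [seq f i | i <- J] by rewrite map_inj_uniq//; exact: can_inj fg.
have := ind _ (fun i => B (g i)) uJ'.
rewrite big_map; under eq_bigr do rewrite fg.
move=> <-; last by move=> _ /mapP[i iJ ->]; rewrite fg; exact: mB.
congr (P _); apply/seteqP; split => w /= h i.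
  by move=> /mapP[j jJ ->]; rewrite fg; exact: h.
by move=> iJ; have := h (f i); rewrite fg; apply; exact: map_f.
Qed.

(** With the noise shifted by N, time K sits at index K + N; the cut-off process there is a partial
    sum of the series for x_K with N + K + 1 terms. *)
Lemma window_sum (R : pzRingType) (c : nat -> R) (y : int -> R) K N :
  \sum_(0 <= u < (K + N).+1) c (K + N - u)%N * y (u%:Z - N%:Z) =
  \sum_(0 <= j < N + K.+1) c j * y (K%:Z - j%:Z).
Proof.
rewrite addnS [(N + K)%N]addnC big_nat_rev/=; apply: eq_big_nat => i /andP[_ iK].
by congr (c _ * y _); lia.
Qed.

Lemma exponents_exist (R : realType) (alpha sigma p : R) :
  1 < alpha < 2 -> 1 / 2 < sigma <= 1 -> 1 <= p -> p < alpha -> p < 2 -> (2 - 2 * sigma) * p < 1 ->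
  exists q beta kappa t : R, [/\ 1 < q <= 2, q < alpha, 0 <= beta & 1 < 2 * kappa + beta] /\
    [/\ 0 <= kappa, kappa <= sigma, 1 < 2 * sigma - kappa,
     Num.max 1 ((1 + beta) * q / 2) < t & t / q < p^-1].
Proof.
move=> /andP[a1 a2] /andP[s1 s2] p1 pa p2 ps.
have p0 : 0 < p by lra.
have vp : p^-1 * p = 1 by rewrite mulVf// gt_eqF.
set v := p^-1 in vp *; have v0 : 0 < v by rewrite invr_gt0.
have v1 : v <= 1 by rewrite invf_le1.
have v2 : 1 < 2 * v by rewrite -(ltr_pM2r p0) mul1r -mulrA vp; lra.
have v3 : 2 - 2 * sigma < v by rewrite -(ltr_pM2r p0) vp.
(* Midpoints throughout. With v = 1/p, b must lie between max(0, 3 - 4 sigma) and 2v - 1, and then k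
   between (1 - b)/2 and 2 sigma - 1. *)
pose q := (p + alpha) / 2; have q1 : 1 < q by rewrite /q; lra.
have q0 : 0 < q by lra.
have qv : 1 < q * v by rewrite -(ltr_pM2r p0) -mulrA vp /q; lra.
have [b [b0 b1 b2]] : exists b : R, [/\ 0 <= b, 3 - 4 * sigma < b & b < 2 * v - 1].
  exists ((Num.max 0 (3 - 4 * sigma) + (2 * v - 1)) / 2).
  have m1 : 0 <= Num.max 0 (3 - 4 * sigma) by rewrite le_max lexx.
  have m2 : 3 - 4 * sigma <= Num.max 0 (3 - 4 * sigma) by rewrite le_max lexx orbT.
  have m3 : Num.max 0 (3 - 4 * sigma) < 2 * v - 1 by rewrite gt_max; apply/andP; split; lra.
  by split; lra.
pose k := ((1 - b) / 2 + (2 * sigma - 1)) / 2.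
have mt : Num.max 1 ((1 + b) * q / 2) < q * v.
  rewrite gt_max qv/= mulrAC -subr_gt0.
  have : 0 < (v - (1 + b) / 2) * q by rewrite mulr_gt0//; lra.
  lra.
pose t := (Num.max 1 ((1 + b) * q / 2) + q * v) / 2.
exists q, b, k, t; split; split => //; rewrite ?q1/=; try by rewrite /q /k; lra.
- by rewrite /t; lra.
- by rewrite ltr_pdivrMr// /t mulrC; lra.
Qed.

Lemma normalized_cvg0 (R : realType) (p e C : R) (S : nat -> R) : e < p^-1 ->
  (forall n, `|S n| <= C * n%:R `^ e) ->
  (n%:R : R) `^ (1 - p^-1) * (n%:R^-1 * S n) @[n --> \oo] --> (0 : R).
Proof.
move=> ep hS; have d0 : 0 < p^-1 - e by rewrite subr_gt0.
have C0 : 0 <= C.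
  by have := hS 1%N; rewrite powR1 mulr1; apply: le_trans.
apply/cvgrPdist_lt => z z0.
(* C may be 0, hence the division by C + 1. *)
have z1 : 0 < z / (C + 1) by rewrite divr_gt0//; lra.
have /cvgrPdist_lt/(_ _ z1) h := cvg_powRN d0.
near=> n; have n0 : (0 < n)%N by near: n; exact: nbhs_infty_gt.
have nz : (n%:R : R) != 0 by rewrite pnatr_eq0 -lt0n.
rewrite sub0r normrN normrM ger0_norm ?powR_ge0// normrM ger0_norm ?invr_ge0//.
apply: (@le_lt_trans _ _ (n%:R `^ (1 - p^-1) * (n%:R^-1 * (C * n%:R `^ e)))).
  by rewrite ler_wpM2l ?powR_ge0// ler_wpM2l ?invr_ge0.
have -> : n%:R `^ (1 - p^-1) * (n%:R^-1 * (C * n%:R `^ e)) = C * (n%:R : R) `^ (- (p^-1 - e)).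
  rewrite [LHS](_ : _ = C * (n%:R `^ (1 - p^-1) * n%:R `^ (-1) * n%:R `^ e)); last first.
    by rewrite powR_inv1//; ring.
  by rewrite -!powRD ?nz ?implybT//; congr (C * (_ `^ _)); ring.
have hn : n%:R `^ (- (p^-1 - e)) < z / (C + 1).
  have : `|0 - (n%:R : R) `^ (- (p^-1 - e))| < z / (C + 1) by near: n; exact: h.
  by rewrite sub0r normrN ger0_norm ?powR_ge0.
apply: (@le_lt_trans _ _ (C * (z / (C + 1)))).
  by rewrite ler_wpM2l// ltW.
by rewrite mulrCA -[ltRHS]mulr1 ltr_pM2l// ltr_pdivrMr; lra.
Unshelve. all: by end_near. Qed.

Lemma is_cvg_autocorrelation (R : realType) (c : nat -> R) (h : nat) (D : R) :
  (forall N, \sum_(0 <= i < N) `|c i * c (i + h)%N| <= D) ->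
  cvgn (fun N => \sum_(0 <= i < N) c i * c (i + h)%N).
Proof.
move=> hD; apply: (@normed_cvg R R (fun i => c i * c (i + h)%N)).
apply: nondecreasing_is_cvgn.
  apply: nondecreasing_series => i _ _; exact: normr_ge0.
by exists D => _ [n _ <-]; exact: hD.
Qed.

Lemma product_cvg (R : realType) (c : nat -> R) (h : nat) (iota : R) (y z : int -> R)
  (s : nat -> nat) (K : nat) :
  (forall k : nat, \sum_(0 <= j < N) c j * y (k%:Z - j%:Z) @[N --> \oo] --> z k%:Z) ->
  cvgn (fun N => \sum_(0 <= i < N) c i * c (i + h)%N) -> (forall N, s N = K + N)%N ->
  (\sum_(0 <= u < (s N).+1) c (s N - u)%N * y (u%:Z - N%:Z)) *
    (\sum_(0 <= u < (s N + h).+1) c (s N + h - u)%N * y (u%:Z - N%:Z)) -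
    iota * \sum_(0 <= i < (s N).+1) c i * c (i + h)%N @[N --> \oo] -->
  z K%:Z * z (K%:Z + h%:Z) - gamma_h iota c h.
Proof.
move=> yz hc sK; have shift (u : nat -> R) (l : R) m : u @ \oo --> l -> u (N + m)%N @[N --> \oo] --> l.
  by rewrite -(cvg_shiftn m).
apply: cvgB.
  apply: cvgM.
    under eq_fun do rewrite sK window_sum.
    exact: (shift (fun n => \sum_(0 <= j < n) c j * y (K%:Z - j%:Z)) _ K.+1 (yz K)).
  under eq_fun do rewrite sK addnAC window_sum.
  rewrite -PoszD.
  exact: (shift (fun n => \sum_(0 <= j < n) c j * y ((K + h)%N%:Z - j%:Z)) _ (K + h).+1 (yz (K + h)%N)).
apply: cvgMr.
under eq_fun do rewrite sK addnC -addnS.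
exact: (shift (fun n => \sum_(0 <= i < n) c i * c (i + h)%N) _ K.+1 hc).
Qed.

Unset Implicit Arguments.

Theorem theorem7 (d : measure_display) (T : measurableType d) (R : realType)
  (P : probability T R) (xi : int -> T -> R) (iota alpha sigma : R)
  (c : nat -> R) (x : int -> T -> R) (h : nat) (p : R) :
  (forall j, measurable_fun setT (xi j)) ->
  mutually_independent P xi ->
  identically_distributed P xi 1%R ->
  P.-integrable setT (fun w => (xi 1%R w)%:E) ->
  ('E_P[xi 1%R] = 0)%E ->
  ('E_P[fun w => (xi 1 w ^+ 2)%R] = iota%:E)%E ->
  1 < alpha < 2 ->
  (exists M : R, forall t : R, 0 <= t ->
     ((t `^ alpha)%:E * P [set w | (t < xi 1 w ^+ 2)%R] <= M%:E)%E) ->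
  1 / 2 < sigma <= 1 ->
  (exists M : R, forall l : nat, l%:R `^ sigma * `|c l| <= M) ->
  (forall k : int, {ae P, forall w,
     (fun N : nat => \sum_(0 <= j < N) c j * xi (k - j%:Z) w) @ \oo --> (x k w : R)}) ->
  0 < p -> p < alpha -> p < 2 -> (2 - 2 * sigma) * p < 1 ->
  {ae P, forall w,
    (fun n : nat => (n%:R : R) `^ (1 - p^-1) * (gamma_hat x h n w - gamma_h iota c h))
      @ \oo --> (0 : R)}.
Proof.
move=> mxi ind idd ixi1 E0 E2 a12 [M hM] s12 [Mc hMc] xlim p0 pa p2 psig.
have [a1 a2] := andP a12; have [s1 s2] := andP s12.
rewrite unlock in E0; rewrite unlock in E2.
pose p' := Num.max 1 p.
have p'1 : 1 <= p' by rewrite /p' le_max lexx.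
have pp' : p <= p' by rewrite /p' le_max lexx orbT.
have p'0 : 0 < p' by exact: lt_le_trans p'1.
have p'a : p' < alpha by rewrite /p' gt_max a1.
have p'2 : p' < 2 by rewrite /p' gt_max p2 andbT; lra.
(* When p' = 1 this is just sigma > 1/2. *)
have p'sig : (2 - 2 * sigma) * p' < 1.
  by rewrite /p'; case: (leP 1 p) => _ //; rewrite mulr1; lra.
have [q [beta [kappa [t [[q12 qa b0 kb] [k0 ks sk tht tq]]]]]] :=
  exponents_exist a12 s12 p'1 p'a p'2 p'sig.
have [q1 q2] := andP q12; have q0 : 0 < q by lra.
set th := Num.max _ _ in tht; have th1 : 1 <= th by rewrite /th le_max lexx.
have msq : measurable_fun setT (fun x : R => x ^+ 2) by exact: measurable_funX.
have sig01 : 0 < sigma <= 1 by rewrite s2 andbT; lra.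
have [M' M'0 hM'] := coeff_decay sig01 hMc.
have [C C0 hC] := autocorrelation_le k0 ks sk M'0 hM'.
have [K1 K10 hK1] := tail_moment (measurableT_comp msq (mxi 1)) (fun w => sqr_ge0 (xi 1 w)) q0 qa hM.
pose K := 4 * (K1 + `|iota| `^ q).
have K0 : 0 <= K by rewrite mulr_ge0// addr_ge0// powR_ge0.
have mcen : measurable_fun setT (fun x : R => `|x ^+ 2 - iota| `^ q).
  apply: (measurableT_comp (measurable_powR _)); apply: measurableT_comp => //.
  exact: measurable_funB.
have hK : (\int[P]_w (`|xi 1 w ^+ 2 - iota| `^ q)%:E <= K%:E)%E.
  apply: (@le_trans _ _ (\int[P]_w (4%:E * (((xi 1 w ^+ 2) `^ q)%:E + (`|iota| `^ q)%:E)))%E).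
    apply: ge0_le_integral => //.
    - by apply/measurable_EFinP; exact: (measurableT_comp mcen).
    - apply: measurable_funeM; apply: emeasurable_funD => //.
      apply/measurable_EFinP; apply: (measurableT_comp (measurable_powR _)).
      exact: (measurableT_comp msq).
    - move=> w _; have q02 : 0 < q <= 2 by rewrite q0.
      have := powR_normD_le2 (xi 1 w ^+ 2) (- iota) q02.
      by rewrite normrN [`|xi 1 w ^+ 2|]ger0_norm ?sqr_ge0// lee_fin.
  have m1 : measurable_fun setT (fun w => ((xi 1 w ^+ 2) `^ q)%:E).
    apply/measurable_EFinP; apply: (measurableT_comp (measurable_powR _)).
    exact: (measurableT_comp msq).
  rewrite ge0_integralZl//; last 2 first.
  - exact: emeasurable_funD.
  - by move=> w _; rewrite adde_ge0// lee_fin powR_ge0.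
  rewrite ge0_integralD//; last by move=> w _; rewrite lee_fin powR_ge0.
  rewrite probability_integral_cst -[leRHS]/(4%:E * (K1%:E + (`|iota| `^ q)%:E))%E.
  by rewrite lee_wpmul2l// leeD.
have [C' C'0 hC'] := @block_moment d T R P c h iota q K C kappa beta q12 b0 kb C0 K0 hC.
(* x_k is approximated by the sum of c_j xi_(k-j) over k - j >= -N, a one-sided process in y N. *)
pose y N (j : nat) := xi (j%:Z - N%:Z).
have y_ident N j B : measurable B -> P (y N j @^-1` B) = P (xi 1 @^-1` B) by exact: idd.
have my N j : measurable_fun setT (y N j) by exact: mxi.
have y_ind N : mutually_independent P (y N).
  have yK : cancel (fun j : nat => j%:Z - N%:Z) (fun z : int => absz (z + N%:Z)).
    by move=> j /=; rewrite subrK.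
  exact: mutually_independent_reindex yK ind.
have ixi2 : P.-integrable setT (fun w => (xi 1 w ^+ 2)%:E).
  apply/integrableP; split; first by apply/measurable_EFinP; exact: (measurableT_comp msq).
  under eq_integral do rewrite gee0_abs ?lee_fin ?sqr_ge0//.
  by rewrite E2 ltry.
have mE : measurable_fun setT (EFin : R -> \bar R) by exact/measurable_EFinP.
have mE2 : measurable_fun setT (fun x : R => (x ^+ 2)%:E) by exact/measurable_EFinP.
have y4 N j : (\int[P]_w (`|y N j w ^+ 2 - iota| `^ q)%:E <= K%:E)%E.
  rewrite (ident_integral (g := fun x => (`|x ^+ 2 - iota| `^ q)%:E) (my N j) (mxi 1) _ (y_ident N j))//.
  exact: (measurableT_comp mE mcen).
have hblock N s m := hC' (y N) (my N) (y_ind N)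
  (fun j => (ident_integrable (my N j) (mxi 1) mE (y_ident N j) ixi1).1)
  (fun j => etrans (ident_integrable (my N j) (mxi 1) mE (y_ident N j) ixi1).2 E0)
  (fun j => (ident_integrable (my N j) (mxi 1) mE2 (y_ident N j) ixi2).1)
  (fun j => etrans (ident_integrable (my N j) (mxi 1) mE2 (y_ident N j) ixi2).2 E2)
  (y4 N) s m.
pose block N s m w := \sum_(0 <= k < m)
       ((\sum_(0 <= u < (s + k).+1) c (s + k - u)%N * y N u w) *
        (\sum_(0 <= u < (s + k + h).+1) c (s + k + h - u)%N * y N u w) -
        iota * \sum_(0 <= i < (s + k).+1) c i * c (i + h)%N).
(* Indices start at 0 here, whereas the times in [gamma_hat] start at 1. *)
pose Z k w := x k.+1%:Z w * x (k.+1%:Z + h%:Z) w - gamma_h iota c h.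
have : {ae P, forall w, exists2 G : R, 0 <= G & forall l b,
    `|\sum_(b * 2 ^ l <= k < b.+1 * 2 ^ l) Z k w| `^ q <= G * ((b.+1 * 2 ^ l)%:R : R) `^ t}.
  (* The offset 1 + N combines that index shift with the shift of the noise by N. *)
  apply: (@ae_dyadic_bound _ _ _ P (fun N l b w => `|block N (b * 2 ^ l + 1 + N)%N (2 ^ l)%N w| `^ q)
    _ C' th t) => //.
  - move=> N l b; apply: (measurableT_comp (measurable_powR _)); apply: measurableT_comp => //.
    rewrite /block; under eq_fun do rewrite big_mkord.
    apply: measurable_sum => i; apply: measurable_funB => //; apply: measurable_funM.
      under eq_fun do rewrite big_mkord.
      by apply: measurable_sum => j; exact: measurable_funM.
    under eq_fun do rewrite big_mkord.
    by apply: measurable_sum => j; exact: measurable_funM.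
  - by move=> N l b; exact: hblock.
  - have := ae_foralln (fun k : nat => xlim k%:Z); apply: filterS => w xw l b.
    apply: cvg_powR_norm; first by rewrite q0.
    rewrite (_ : \sum_(b * 2 ^ l <= k < b.+1 * 2 ^ l) Z k w =
      \sum_(0 <= k < 2 ^ l) Z (k + b * 2 ^ l)%N w); last first.
      by rewrite -{1}[(b * 2 ^ l)%N]add0n big_addn mulSn addnK.
    apply: cvg_big; first exact: add_continuous.
    move=> k _.
    rewrite /Z; apply: (@product_cvg _ c h iota (fun z => xi z w) (x ^~ w)) => //.
      exact: (is_cvg_autocorrelation (hC ^~ h)).
    by move=> N; rewrite addnAC addn1 addSn [(k + _)%N]addnC.
apply: filterS => w [G G0 hG].
(* The q-th root turns the exponent t into tau; eps is half of the gap left below 1/p'. *)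
pose tau := t / q; pose eps := (p'^-1 - tau) / 2.
have eps0 : 0 < eps by rewrite /eps /tau; lra.
have tau0 : 0 <= tau by rewrite /tau divr_ge0//; lra.
have H0 : 0 <= G `^ q^-1 by exact: powR_ge0.
have [|D hD] := @dyadic_chaining R (Z ^~ w) tau eps (G `^ q^-1) eps0 tau0 H0.
  move=> l b.
  have := le_powRl _ (powR_ge0 _ _) (hG l b) (r := q^-1).
  rewrite invr_ge0 (ltW q0) => /(_ isT).
  rewrite -powRrM mulfV ?gt_eqF// powRr1// powRM ?powR_ge0// -powRrM.
  exact.
have tp : tau + eps < p^-1.
  apply: (@lt_le_trans _ _ p'^-1); first by rewrite /eps /tau; lra.
  by rewrite lef_pV2.
(* Equality is needed only for n > 0: at n = 0 the convention 0^-1 = 0 would lose the subtracted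
   [gamma_h]. *)
apply: cvg_trans (normalized_cvg0 tp hD); apply: near_eq_cvg; near=> n.
have n0 : (0 < n)%N by near: n; exact: nbhs_infty_gt.
congr (_ * _); rewrite /gamma_hat big_add1/= /Z sumrB sumr_const_nat subn0 mulrBr.
by congr (_ - _); rewrite -[gamma_h iota c h *+ n]mulr_natl mulrA mulVf ?mul1r// pnatr_eq0 -lt0n.
Unshelve. all: by end_near. Qed.
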